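(* Let $H=(H,\mu,\eta,\Delta,\epsilon,S)$ be a Hopf algebra over a unital commutative ring $\mathbb{k}$, regarded as a braided algebra $(H,\mu,R_H)$ with the Yang-Baxter operator $R_H(x\otimes y)=y^{(1)}\otimes S(y^{(2)})xy^{(3)}$. Then the assignment $(\xi,\zeta)\mapsto(\Psi_\zeta(\xi),\xi)$ on normalized Hopf algebra $2$-cocycles induces a well defined homomorphism $$\Psi:\hat H^2_{\rm Hf}(H,H)\longrightarrow H^2_{\rm YBH}(H,H).$$ Moreover, if $[(\xi,\zeta)]\in\hat H^2_{\rm Hf}(H,H)$ is such that $0\neq[\xi]\in H^2_{\rm H}(H,H)$ (second Hochschild cohomology), then $\Psi([(\xi,\zeta)])$ is a nonzero class in $H^2_{\rm YBH}(H,H)$.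
   Context: $\otimes=\otimes_{\mathbb{k}}$, $\mathrm{Hom}=\mathrm{Hom}_{\mathbb{k}}$; $1$ denotes the identity map (or the unit element of $H$ when used as an element). Sweedler notation: $\Delta(x)=x^{(1)}\otimes x^{(2)}$, iterated coproduct $x^{(1)}\otimes x^{(2)}\otimes x^{(3)}$; juxtaposition is multiplication. Braided algebras: a Yang-Baxter (YB) operator on $V$ is an invertible $R:V\otimes V\to V\otimes V$ with $(R\otimes 1)(1\otimes R)(R\otimes 1)=(1\otimes R)(R\otimes 1)(1\otimes R)$; a braided algebra $(V,\mu,R)$ is an associative algebra with a YB operator satisfying $(1\otimes\mu)(R\otimes 1)(1\otimes R)=R(\mu\otimes 1)$ and $(\mu\otimes 1)(1\otimes R)(R\otimes 1)=R(1\otimes\mu)$. It is taken as known that $R_H$ is a YB operator and that $(H,\mu,R_H)$ is a braided algebra. Normalized Hopf $2$-cocycles: $\hat Z^2_{\rm Hf}(H,H)$ is the group of pairs $(\xi,\zeta)$, $\xi\in\mathrm{Hom}(H^{\otimes 2},H)$, $\zeta\in\mathrm{Hom}(H,H^{\otimes 2})$, with, for all $x,y,z\in H$: $\xi(x\otimes y)z+\xi(xy\otimes z)=x\xi(y\otimes z)+\xi(x\otimes yz)$; $x^{(1)}\otimes\zeta(x^{(2)})+(1\otimes\Delta)\zeta(x)=\zeta(x^{(1)})\otimes x^{(2)}+(\Delta\otimes 1)\zeta(x)$; $\Delta(\xi(x\otimes y))+\zeta(xy)=x^{(1)}y^{(1)}\otimes\xi(x^{(2)}\otimes y^{(2)})+\xi(x^{(1)}\otimes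 y^{(1)})\otimes x^{(2)}y^{(2)}+\zeta(x)\Delta(y)+\Delta(x)\zeta(y)$; and the normalization $\xi(1\otimes x)=\xi(x\otimes 1)=0$, $(1\otimes\epsilon)\zeta(x)=(\epsilon\otimes 1)\zeta(x)=0$. Coboundaries: $B_{\rm Hf}(H,H)$ consists of the pairs $(\mu(1\otimes f)+\mu(f\otimes 1)-f\mu,\ \Delta f-(f\otimes 1+1\otimes f)\Delta)$ with $f\in\mathrm{Hom}(H,H)$. $\hat H^2_{\rm Hf}(H,H)=\hat Z^2_{\rm Hf}(H,H)/(B_{\rm Hf}(H,H)\cap\hat Z^2_{\rm Hf}(H,H))$. The map: for $(\xi,\zeta)\in\hat Z^2_{\rm Hf}(H,H)$ define $S'\in\mathrm{Hom}(H,H)$ by $S'(x)=-S(x^{(1)})\xi(x^{(2)}\otimes S(x^{(3)}))-S(x^{(1)})\,\mu\bigl((1\otimes S)\zeta(x^{(2)})\bigr)$ (the degree-one term of the antipode of the deformed Hopf algebra $\mu+\hbar\xi$, $\Delta+\hbar\zeta$). Write $(1\otimes\Delta)\zeta(y)={}_{(1)}y\otimes{}_{(2)}y\otimes{}_{(3)}y$ and $(1\otimes\zeta)\Delta(y)={}^{(1)}y\otimes{}^{(2)}y\otimes{}^{(3)}y$. Then $\Psi_\zeta(\xi):H\otimes H\to H\otimes H$ is $\Psi_\zeta(\xi)(x\otimes y)=y^{(1)}\otimes S(y^{(2)})\xi(x\otimes y^{(3)})+y^{(1)}\otimes\xi(S(y^{(2)})\otimes xy^{(3)})+{}_{(1)}y\otimes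 S({}_{(2)}y)\,x\,{}_{(3)}y+{}^{(1)}y\otimes S({}^{(2)}y)\,x\,{}^{(3)}y+y^{(1)}\otimes S'(y^{(2)})xy^{(3)}$. Cohomology of a braided algebra $(V,\mu,R)$: cochains $f\in C^1_{\rm YBH}=\mathrm{Hom}(V,V)$, $(\phi,\psi)\in C^2_{\rm YBH}=\mathrm{Hom}(V^{\otimes 2},V^{\otimes 2})\oplus\mathrm{Hom}(V^{\otimes 2},V)$; $\delta^1_{\rm YBH}(f)=(\delta^1_{\rm YB}(f),\delta^1_{\rm H}(f))$, $\delta^2_{\rm YBH}(\phi,\psi)=\delta^2_{\rm YB}(\phi)\oplus\delta^2_{\rm YI}(\phi\oplus\psi)\oplus\delta^2_{\rm IY}(\phi\oplus\psi)\oplus\delta^2_{\rm H}(\psi)$, where $\delta^1_{\rm YB}(f)=R(f\otimes 1)+R(1\otimes f)-(f\otimes 1)R-(1\otimes f)R$; $\delta^1_{\rm H}(f)=\mu(f\otimes 1)+\mu(1\otimes f)-f\mu$; $\delta^2_{\rm YB}(\phi)=(R\otimes 1)(1\otimes R)(\phi\otimes 1)+(R\otimes 1)(1\otimes\phi)(R\otimes 1)+(\phi\otimes 1)(1\otimes R)(R\otimes 1)-(1\otimes R)(R\otimes 1)(1\otimes\phi)-(1\otimes R)(\phi\otimes 1)(1\otimes R)-(1\otimes\phi)(R\otimes 1)(1\otimes R)$; $\delta^2_{\rm H}(\psi)=\mu(\psi\otimes 1)+\psi(\mu\otimes 1)-\mu(1\otimes\psi)-\psi(1\otimes\mu)$;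 $\delta^2_{\rm YI}(\phi\oplus\psi)=(1\otimes\psi)(R\otimes 1)(1\otimes R)+(1\otimes\mu)(\phi\otimes 1)(1\otimes R)+(1\otimes\mu)(R\otimes 1)(1\otimes\phi)-R(\psi\otimes 1)-\phi(\mu\otimes 1)$; $\delta^2_{\rm IY}(\phi\oplus\psi)=(\psi\otimes 1)(1\otimes R)(R\otimes 1)+(\mu\otimes 1)(1\otimes\phi)(R\otimes 1)+(\mu\otimes 1)(1\otimes R)(\phi\otimes 1)-R(1\otimes\psi)-\phi(1\otimes\mu)$. $H^2_{\rm YBH}=\ker\delta^2_{\rm YBH}/\mathrm{Im}\,\delta^1_{\rm YBH}$ and $H^2_{\rm H}=\ker\delta^2_{\rm H}/\mathrm{Im}\,\delta^1_{\rm H}$. *)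

(* Defs.v *)
From HB Require Import structures.
#[warnings="-all"]
From mathcomp Require Import all_boot all_order all_algebra.
From mathcomp Require Import generic_quotient ring_quotient sesquilinear.
#[warnings="-all"]
From mathcomp Require Import boolp.

Set Implicit Arguments.
Unset Strict Implicit.
Unset Printing Implicit Defensive.

Import GRing.Theory.
Local Open Scope ring_scope.
Local Open Scope quotient_scope.

Notation bilinearf F := (bilinear_for *:%R *:%R F).

(* U ⨂ V is the tensor product of two modules, u ⊗ v a pure tensor and f ⊠ g the
   tensor product of two linear maps. *)
Reserved Notation "U ⨂ V" (at level 35, right associativity).
Reserved Notation "u ⊗ v" (at level 35, right associativity).
Reserved Notation "f ⊠ g" (at level 35, right associativity).
Reserved Notation "g ∘ f" (at level 40, left associativity).
Reserved Notation "'\sw_' ( a , b <- t ) E"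
  (at level 41, a name, b name, E at level 41, right associativity,
   format "'\sw_' ( a ,  b  <-  t )  E").
Reserved Notation "'\sw_' ( a , b , c <- t ) E"
  (at level 41, a name, b name, c name, E at level 41, right associativity,
   format "'\sw_' ( a ,  b ,  c  <-  t )  E").

Section LinearMaps.
Variables (k : comNzRingType) (U V : lmodType k).
Implicit Types (a b : k) (f g h : {linear U -> V}).

HB.instance Definition _ := gen_eqMixin {linear U -> V}.
HB.instance Definition _ := gen_choiceMixin {linear U -> V}.

Lemma lmapP f g : f =1 g -> f = g.
Proof.
case: f g => [f cf] [g cg] /= /funext fg; subst g.
suff -> : cf = cg by [].
case: cf cg => [[Df] [Zf]] [[Dg] [Zg]].
by rewrite (Prop_irrelevance Df Dg) (Prop_irrelevance Zf Zg).
Qed.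

Definition lmap_zero : {linear U -> V} := \0.
Definition lmap_add f g : {linear U -> V} := f \+ g.
Definition lmap_opp f : {linear U -> V} := \- f.
Definition lmap_scale a f : {linear U -> V} := a \*: f.

Fact lmap_addA : associative lmap_add.
Proof. by move=> f g h; apply: lmapP => x /=; rewrite addrA. Qed.
Fact lmap_addC : commutative lmap_add.
Proof. by move=> f g; apply: lmapP => x /=; rewrite addrC. Qed.
Fact lmap_add0 : left_id lmap_zero lmap_add.
Proof. by move=> f; apply: lmapP => x /=; rewrite add0r. Qed.
Fact lmap_addN : left_inverse lmap_zero lmap_opp lmap_add.
Proof. by move=> f; apply: lmapP => x /=; rewrite addNr. Qed.
HB.instance Definition _ := GRing.isZmodule.Build {linear U -> V}
  lmap_addA lmap_addC lmap_add0 lmap_addN.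

Fact lmap_scaleA a b f : lmap_scale a (lmap_scale b f) = lmap_scale (a * b) f.
Proof. by apply: lmapP => x /=; rewrite scalerA. Qed.
Fact lmap_scale1 : left_id 1 lmap_scale.
Proof. by move=> f; apply: lmapP => x /=; rewrite scale1r. Qed.
Fact lmap_scaleDr : right_distributive lmap_scale +%R.
Proof. by move=> a f g; apply: lmapP => x /=; rewrite scalerDr. Qed.
Fact lmap_scaleDl f : {morph lmap_scale^~ f : a b / a + b}.
Proof. by move=> a b; apply: lmapP => x /=; rewrite scalerDl. Qed.
HB.instance Definition _ := GRing.Zmodule_isLmodule.Build k {linear U -> V}
  lmap_scaleA lmap_scale1 lmap_scaleDr lmap_scaleDl.

Lemma lmap0E x : (0 : {linear U -> V}) x = 0. Proof. by []. Qed.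
Lemma lmapDE f g x : (f + g) x = f x + g x. Proof. by []. Qed.
Lemma lmapNE f x : (- f) x = - f x. Proof. by []. Qed.
Lemma lmapZE a f x : (a *: f) x = a *: f x. Proof. by []. Qed.
End LinearMaps.

Section LinearComposition.
Variables (k : comNzRingType) (U V W : lmodType k).
Definition lid : {linear U -> U} := idfun.
Definition lcomp (g : {linear V -> W}) (f : {linear U -> V}) :
  {linear U -> W} := g \o f.
End LinearComposition.
Arguments lid {k U}.
Notation "g ∘ f" := (lcomp g f) : ring_scope.

Section MkLinear.
Variables (k : comNzRingType) (U V : lmodType k) (F : U -> V).
Hypothesis linF : linear F.
Definition mk_linear_fun & linear F := F.
HB.instance Definition _ := GRing.isLinear.Build k U V *:%R
  (mk_linear_fun linF) linF.
Definition mk_linear : {linear U -> V} := mk_linear_fun linF.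
End MkLinear.

Section SubModule.
Variables (k : comNzRingType) (M : lmodType k) (Z : submodClosed M).
Record submod := SubMod {submod_val :> M; _ : submod_val \in Z}.
HB.instance Definition _ := [isSub for submod_val].
HB.instance Definition _ := [Choice of submod by <:].
HB.instance Definition _ := [SubChoice_isSubLmodule of submod by <:].
End SubModule.

Section QuotientModule.
Variables (k : comNzRingType) (M : lmodType k) (N : submodClosed M).
Definition quot_pred : {pred M} := fun x => x \in N.

Fact quot_pred_submod : GRing.subsemimod_closed quot_pred.
Proof.
split; first by split=> [|x y]; [apply: rpred0|apply: rpredD].
by move=> a x; apply: rpredZ.
Qed.
HB.instance Definition _ := GRing.isSubmodClosed.Build k M quot_pred
  quot_pred_submod.

Definition quotmod := Quotient.quot quot_pred.
HB.instance Definition _ := GRing.Zmodule.on quotmod.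

Definition quotmod_pi_fun (x : M) : quotmod := \pi_(Quotient.quot quot_pred) x.

Lemma quotmod_eqE x y :
  (quotmod_pi_fun x == quotmod_pi_fun y) = (x - y \in N).
Proof. by rewrite -Quotient.idealrBE. Qed.

Fact quotmod_piD : {morph quotmod_pi_fun : x y / x + y}.
Proof. by move=> x y; rewrite /quotmod_pi_fun raddfD. Qed.

Lemma quotmod_piP (q : quotmod) : exists x, q = quotmod_pi_fun x.
Proof. by exists (repr q); rewrite /quotmod_pi_fun reprK. Qed.

Definition quotmod_scale a (q : quotmod) := quotmod_pi_fun (a *: repr q).

Fact quotmod_piZ a x :
  quotmod_scale a (quotmod_pi_fun x) = quotmod_pi_fun (a *: x).
Proof.
apply/eqP; rewrite quotmod_eqE -scalerBr rpredZ // -quotmod_eqE.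
by rewrite /quotmod_pi_fun reprK.
Qed.

Fact quotmod_scaleA a b q :
  quotmod_scale a (quotmod_scale b q) = quotmod_scale (a * b) q.
Proof. by have [x ->] := quotmod_piP q; rewrite !quotmod_piZ scalerA. Qed.
Fact quotmod_scale1 : left_id 1 quotmod_scale.
Proof.
by move=> q; have [x ->] := quotmod_piP q; rewrite quotmod_piZ scale1r.
Qed.
Fact quotmod_scaleDr : right_distributive quotmod_scale +%R.
Proof.
move=> a q r; have [x ->] := quotmod_piP q; have [y ->] := quotmod_piP r.
by rewrite -quotmod_piD !quotmod_piZ -quotmod_piD scalerDr.
Qed.
Fact quotmod_scaleDl q : {morph quotmod_scale^~ q : a b / a + b}.
Proof.
move=> a b; have [x ->] := quotmod_piP q.
by rewrite !quotmod_piZ -quotmod_piD scalerDl.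
Qed.
HB.instance Definition _ := GRing.Zmodule_isLmodule.Build k quotmod
  quotmod_scaleA quotmod_scale1 quotmod_scaleDr quotmod_scaleDl.

Fact quotmod_pi_linear : linear quotmod_pi_fun.
Proof. by move=> a x y; rewrite quotmod_piD -quotmod_piZ. Qed.
Definition quotmod_pi : {linear M -> quotmod} := mk_linear quotmod_pi_linear.

Lemma quotmod_piE x y : (quotmod_pi x == quotmod_pi y) = (x - y \in N).
Proof. exact: quotmod_eqE. Qed.

Lemma quotmod_pi_surj (q : quotmod) : exists x, q = quotmod_pi x.
Proof. exact: quotmod_piP. Qed.
End QuotientModule.

Section SubQuotient.
Variables (k : comNzRingType) (M : lmodType k) (Z B : submodClosed M).
Definition restr_pred : {pred submod Z} := fun z => submod_val z \in B.

Fact restr_pred_submod : GRing.subsemimod_closed restr_pred.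
Proof.
split; first by split=> [|x y]; [apply: rpred0|apply: rpredD].
by move=> a x; apply: rpredZ.
Qed.
HB.instance Definition _ := GRing.isSubmodClosed.Build k (submod Z) restr_pred
  restr_pred_submod.

(* Z / (B ∩ Z), which is Z / B when B is contained in Z *)
Definition subquot := quotmod restr_pred.
HB.instance Definition _ := GRing.Lmodule.on subquot.
Definition subquot_class : {linear submod Z -> subquot} :=
  quotmod_pi restr_pred.

Lemma subquot_classE (x y : submod Z) :
  (subquot_class x == subquot_class y) =
  (submod_val x - submod_val y \in B).
Proof. exact: quotmod_piE. Qed.

Lemma subquot_class_surj (q : subquot) : exists z, q = subquot_class z.
Proof. exact: quotmod_pi_surj. Qed.
End SubQuotient.

Section KernelImage.
Variables (k : comNzRingType) (U V : lmodType k) (f : {linear U -> V}).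
Definition ker_pred : {pred U} := fun x => f x == 0.
Definition im_pred : {pred V} := fun y => `[< exists x, f x = y >].

Fact ker_submod : GRing.subsemimod_closed ker_pred.
Proof.
split=> [|a x /eqP fx0]; last by apply/eqP; rewrite linearZ fx0 /= scaler0.
split=> [|x y /eqP fx0 /eqP fy0]; first by apply/eqP; rewrite linear0.
by apply/eqP; rewrite linearD fx0 fy0 addr0.
Qed.
HB.instance Definition _ := GRing.isSubmodClosed.Build k U ker_pred ker_submod.

Fact im_submod : GRing.subsemimod_closed im_pred.
Proof.
split=> [|a _ /asboolP[x <-]]; last by apply/asboolP; exists (a *: x);
  rewrite linearZ.
split=> [|_ _ /asboolP[x <-] /asboolP[y <-]]; apply/asboolP.
  by exists 0; rewrite linear0.
by exists (x + y); rewrite linearD.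
Qed.
HB.instance Definition _ := GRing.isSubmodClosed.Build k V im_pred im_submod.
End KernelImage.

Section Tensor.
Variables (k : comNzRingType) (U V : lmodType k).
Implicit Types (a b : k) (u : U) (v : V) (s t : seq (U * V)).

(* The tensor product is the module generated by the pure tensors, subject to
   the bilinearity relations: it is the quotient of formal sums by the
   congruence tensor_eq; see tliftE and tlift_unique for its universal property.
   A sequence [:: (u1, v1); ...] stands for the formal sum of the pure
   tensors u_i ⊗ v_i. *)
Inductive tensor_eq : seq (U * V) -> seq (U * V) -> Prop :=
| tensor_eq_refl s : tensor_eq s s
| tensor_eq_sym s t : tensor_eq s t -> tensor_eq t s
| tensor_eq_trans s t r : tensor_eq s t -> tensor_eq t r -> tensor_eq s r
| tensor_eq_cat s s' t t' :
    tensor_eq s s' -> tensor_eq t t' -> tensor_eq (s ++ t) (s' ++ t')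
| tensor_eq_catC s t : tensor_eq (s ++ t) (t ++ s)
| tensor_eq_Dl u u' v : tensor_eq [:: (u + u', v)] [:: (u, v); (u', v)]
| tensor_eq_Dr u v v' : tensor_eq [:: (u, v + v')] [:: (u, v); (u, v')]
| tensor_eq_Z a u v : tensor_eq [:: (a *: u, v)] [:: (u, a *: v)]
| tensor_eq_0 v : tensor_eq [:: (0, v)] [::].

Definition tensor_eqb : rel (seq (U * V)) := fun s t => `[< tensor_eq s t >].

Fact tensor_eqb_equiv : equiv_class_of tensor_eqb.
Proof.
split=> [s|s t|t s r].
- by apply/asboolP; apply: tensor_eq_refl.
- by apply/asboolP/asboolP; apply: tensor_eq_sym.
- move=> /asboolP st /asboolP tr; apply/asboolP.
  exact: tensor_eq_trans st tr.
Qed.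
Canonical tensor_equiv := EquivRelPack tensor_eqb_equiv.
Canonical tensor_encModRel := defaultEncModRel tensor_eqb.

Definition tensor := {eq_quot tensor_eqb}.
HB.instance Definition _ := Choice.on tensor.

Definition tensor_pi s : tensor := \pi_({eq_quot tensor_eqb}) s.
Definition tensor_repr (t : tensor) : seq (U * V) := repr t.

Lemma tensor_reprK : cancel tensor_repr tensor_pi.
Proof. exact: reprK. Qed.

Lemma tensor_piP s t : tensor_eq s t <-> tensor_pi s = tensor_pi t.
Proof.
split=> [st|/eqP]; first by apply/eqP; rewrite eqmodE; apply/asboolP.
by rewrite eqmodE => /asboolP.
Qed.

Lemma tensor_repr_pi s : tensor_eq (tensor_repr (tensor_pi s)) s.
Proof. by apply/tensor_piP; rewrite tensor_reprK. Qed.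

Definition tensor_add (x y : tensor) :=
  tensor_pi (tensor_repr x ++ tensor_repr y).
Definition scale_seq a s := [seq (a *: p.1, p.2) | p <- s].
Definition tensor_scale a (x : tensor) := tensor_pi (scale_seq a (tensor_repr x)).
Definition tensor_opp := tensor_scale (-1).
Definition tensor_zero := tensor_pi [::].

Lemma tensor_pi_cat s t :
  tensor_add (tensor_pi s) (tensor_pi t) = tensor_pi (s ++ t).
Proof. by apply/tensor_piP/tensor_eq_cat; apply: tensor_repr_pi. Qed.

Lemma tensor_eq_scale a s t :
  tensor_eq s t -> tensor_eq (scale_seq a s) (scale_seq a t).
Proof.
rewrite /scale_seq; elim=> {s t} /=; rewrite ?map_cat.
- by move=> s; apply: tensor_eq_refl.
- by move=> s t _; apply: tensor_eq_sym.
- by move=> s t r _ + _; apply: tensor_eq_trans.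
- by move=> s s' t t' _ st _; rewrite !map_cat; apply: tensor_eq_cat.
- by move=> s t; rewrite !map_cat; apply: tensor_eq_catC.
- by move=> u u' v; rewrite scalerDr; apply: tensor_eq_Dl.
- by move=> u v v'; apply: tensor_eq_Dr.
- by move=> b u v; rewrite scalerA mulrC -scalerA; apply: tensor_eq_Z.
- by move=> v; rewrite scaler0; apply: tensor_eq_0.
Qed.

Lemma tensor_pi_scale a s :
  tensor_scale a (tensor_pi s) = tensor_pi (scale_seq a s).
Proof. by apply/tensor_piP/tensor_eq_scale/tensor_repr_pi. Qed.

Fact tensor_addA : associative tensor_add.
Proof.
move=> x y z; rewrite -[x]tensor_reprK -[y]tensor_reprK -[z]tensor_reprK.
by rewrite !tensor_pi_cat catA.
Qed.
Fact tensor_addC : commutative tensor_add.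
Proof. by move=> x y; apply/tensor_piP/tensor_eq_catC. Qed.
Fact tensor_add0 : left_id tensor_zero tensor_add.
Proof. by move=> x; rewrite -[x]tensor_reprK tensor_pi_cat. Qed.

Fact tensor_scaleA a b x :
  tensor_scale a (tensor_scale b x) = tensor_scale (a * b) x.
Proof.
rewrite -[x]tensor_reprK !tensor_pi_scale; congr tensor_pi.
by rewrite /scale_seq -map_comp; apply: eq_map => -[u v] /=; rewrite scalerA.
Qed.
Fact tensor_scale1 : left_id 1 tensor_scale.
Proof.
move=> x; rewrite -[x]tensor_reprK tensor_pi_scale; congr tensor_pi.
by rewrite /scale_seq map_id_in // => -[u v] _ /=; rewrite scale1r.
Qed.
Fact tensor_scaleDr : right_distributive tensor_scale tensor_add.
Proof.
move=> a x y; rewrite -[x]tensor_reprK -[y]tensor_reprK.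
by rewrite !(tensor_pi_cat, tensor_pi_scale) /scale_seq map_cat.
Qed.
Fact tensor_scaleDl x a b :
  tensor_scale (a + b) x = tensor_add (tensor_scale a x) (tensor_scale b x).
Proof.
rewrite -[x]tensor_reprK !(tensor_pi_cat, tensor_pi_scale).
apply/tensor_piP; elim: (tensor_repr x) => [|[u v] s IHs] /=.
  exact: tensor_eq_refl.
set sa := scale_seq a s; set sb := scale_seq b s.
apply: (tensor_eq_trans (t := [:: (a *: u, v); (b *: u, v)] ++ (sa ++ sb))).
  apply: (@tensor_eq_cat [:: _]) => //.
  by rewrite scalerDl; apply: tensor_eq_Dl.
rewrite /= -cat_rcons -cats1.
apply: (@tensor_eq_cat [:: _] [:: _]); first exact: tensor_eq_refl.
apply: (@tensor_eq_cat (_ :: sa)); last exact: tensor_eq_refl.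
exact: (tensor_eq_catC [:: _] sa).
Qed.
Fact tensor_scale0 x : tensor_scale 0 x = tensor_zero.
Proof.
rewrite -[x]tensor_reprK tensor_pi_scale; apply/tensor_piP.
elim: (tensor_repr x) => [|[u v] s IHs] /=; first exact: tensor_eq_refl.
rewrite scale0r; apply: (@tensor_eq_cat [:: _] [::] _ [::]) => //.
exact: tensor_eq_0.
Qed.
Fact tensor_addN : left_inverse tensor_zero tensor_opp tensor_add.
Proof.
move=> x; rewrite -[x in tensor_add _ x]tensor_scale1 -tensor_scaleDl.
by rewrite addNr tensor_scale0.
Qed.

HB.instance Definition _ := GRing.isZmodule.Build tensor
  tensor_addA tensor_addC tensor_add0 tensor_addN.
HB.instance Definition _ := GRing.Zmodule_isLmodule.Build k tensor
  tensor_scaleA tensor_scale1 tensor_scaleDr tensor_scaleDl.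

Definition tens u v : tensor := tensor_pi [:: (u, v)].

Fact tens_linear_l v : linear (tens^~ v).
Proof.
move=> a u u'; rewrite [RHS]/GRing.add /= [in RHS]/GRing.scale /=.
by rewrite tensor_pi_scale tensor_pi_cat; apply/tensor_piP/tensor_eq_Dl.
Qed.
Fact tens_linear_r u : linear (tens u).
Proof.
move=> a v v'; rewrite [RHS]/GRing.add /= [in RHS]/GRing.scale /=.
rewrite tensor_pi_scale tensor_pi_cat; apply/tensor_piP.
apply: tensor_eq_trans (tensor_eq_Dr _ _ _) _.
apply: (@tensor_eq_cat [:: _] [:: _]).
  exact/tensor_eq_sym/tensor_eq_Z.
exact: tensor_eq_refl.
Qed.
Lemma tens_bilinear : bilinearf tens.
Proof. by split=> x; [apply: tens_linear_l|apply: tens_linear_r]. Qed.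

Lemma tensor_sumE (x : tensor) : x = \sum_(p <- tensor_repr x) tens p.1 p.2.
Proof.
rewrite -[LHS]tensor_reprK; elim: (tensor_repr x) => [|p s IHs].
  by rewrite big_nil.
by rewrite big_cons -IHs [RHS]/GRing.add /= tensor_pi_cat; case: p.
Qed.
End Tensor.

Notation "U ⨂ V" := (tensor U V).
Notation "u ⊗ v" := (tens u v) : ring_scope.

Section LinearClosure.
Variables (k : comNzRingType) (U V W X : lmodType k).

Lemma lin_id : linear (fun x : U => x).
Proof. by []. Qed.

Lemma lin_map (f : {linear U -> V}) : linear f.
Proof. exact: linearP. Qed.

Lemma lin_add (F G : U -> V) :
  linear F -> linear G -> linear (fun x => F x + G x).
Proof. by move=> linF linG a x y; rewrite linF linG scalerDr addrACA. Qed.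

Lemma lin_opp (F : U -> V) : linear F -> linear (fun x => - F x).
Proof. by move=> linF a x y; rewrite linF opprD scalerN. Qed.

Lemma lin_sum (I : Type) (r : seq I) (F : I -> U -> V) :
  (forall i, linear (F i)) -> linear (fun x => \sum_(i <- r) F i x).
Proof.
move=> linF a x y; rewrite scaler_sumr -big_split /=.
by apply: eq_bigr => i _; apply: linF.
Qed.

Lemma lin_comp (f : {linear V -> W}) (F : U -> V) :
  linear F -> linear (fun x => f (F x)).
Proof. by move=> linF a x y; rewrite linF linearP. Qed.

Lemma lin_pair (F : U -> V) (G : U -> W) :
  linear F -> linear G -> linear (fun x => (F x, G x)).
Proof. by move=> linF linG a x y; rewrite linF linG. Qed.

Lemma lin_fst (F : U -> (V * W)%type) :
  linear F -> linear (fun x => (F x).1).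
Proof. by move=> linF a x y; rewrite linF. Qed.

Lemma lin_snd (F : U -> (V * W)%type) :
  linear F -> linear (fun x => (F x).2).
Proof. by move=> linF a x y; rewrite linF. Qed.

Lemma lin_eval (F : U -> {linear V -> W}) v :
  linear F -> linear (fun x => F x v).
Proof. by move=> linF a x y; rewrite linF. Qed.

Lemma lin_bil_l (B : V -> W -> X) (F : U -> V) w :
  bilinearf B -> linear F -> linear (fun x => B (F x) w).
Proof. by move=> bilB linF a x y; rewrite linF bilB.1. Qed.

Lemma lin_bil_r (B : V -> W -> X) v (F : U -> W) :
  bilinearf B -> linear F -> linear (fun x => B v (F x)).
Proof. by move=> bilB linF a x y; rewrite linF bilB.2. Qed.
End LinearClosure.

Lemma lin_mull (k : comNzRingType) (U : lmodType k) (A : algType k)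
  (F : U -> A) y : linear F -> linear (fun x => F x * y).
Proof. by move=> linF a x z; rewrite linF mulrDl scalerAl. Qed.

Lemma lin_mulr (k : comNzRingType) (U : lmodType k) (A : algType k)
  y (F : U -> A) : linear F -> linear (fun x => y * F x).
Proof. by move=> linF a x z; rewrite linF mulrDr scalerAr. Qed.

Lemma lin_scale (k : comNzRingType) (U V : lmodType k) a (F : U -> V) :
  linear F -> linear (fun x => a *: F x).
Proof.
by move=> linF b x y; rewrite linF scalerDr !scalerA [a * b]mulrC.
Qed.

Lemma lin_scalar (k : comNzRingType) (U V W : lmodType k) (e : {scalar V})
  (F : U -> V) (w : W) : linear F -> linear (fun x => e (F x) *: w).
Proof. by move=> linF b x y; rewrite linF linearP scalerDl scalerA. Qed.

Section TensorSum.
Variables (k : comNzRingType) (U V W X : lmodType k).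

(* \sw_(a, b <- t) F a b is the sum of the F a_i b_i for a chosen
   decomposition t = \sum_i a_i ⊗ b_i.  It does not depend on this choice as
   soon as F is bilinearf (lemma tsum_pi). *)
Definition tsum (t : U ⨂ V) (F : U -> V -> W) : W :=
  \sum_(p <- tensor_repr t) F p.1 p.2.

Lemma tsum_eq (F : U -> V -> W) s t : bilinearf F -> tensor_eq s t ->
  \sum_(p <- s) F p.1 p.2 = \sum_(p <- t) F p.1 p.2.
Proof.
move=> bilF.
have F0 v : F 0 v = 0 := linear0 (mk_linear (bilF.1 v)).
have FDl u u' v : F (u + u') v = F u v + F u' v :=
  linearD (mk_linear (bilF.1 v)) u u'.
have FDr u v v' : F u (v + v') = F u v + F u v' :=
  linearD (mk_linear (bilF.2 u)) v v'.
have FZ a u v : F (a *: u) v = F u (a *: v).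
  transitivity (a *: F u v); first exact: (linearZZ (mk_linear (bilF.1 v)) a u).
  exact: esym (linearZZ (mk_linear (bilF.2 u)) a v).
elim=> {s t} //=.
- by move=> s t r _ -> _ ->.
- by move=> s s' t t' _ IHs _ IHt; rewrite !big_cat /= IHs IHt.
- by move=> s t; rewrite !big_cat /= addrC.
- by move=> u u' v; rewrite !big_cons !big_nil /= !addr0.
- by move=> u v v'; rewrite !big_cons !big_nil /= !addr0.
- by move=> a u v; rewrite !big_cons !big_nil /= !addr0.
- by move=> v; rewrite !big_cons !big_nil /= F0 addr0.
Qed.

Lemma tsum_pi (F : U -> V -> W) s : bilinearf F ->
  tsum (tensor_pi s) F = \sum_(p <- s) F p.1 p.2.
Proof. by move=> bilF; apply: tsum_eq bilF (tensor_repr_pi s). Qed.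

Lemma tsum_tens (F : U -> V -> W) u v : bilinearf F -> tsum (u ⊗ v) F = F u v.
Proof. by move=> bilF; rewrite tsum_pi // big_seq1. Qed.

Lemma tsum_linear (F : U -> V -> W) : bilinearf F -> linear (tsum^~ F).
Proof.
move=> bilF a s t; rewrite -[s]tensor_reprK -[t]tensor_reprK.
rewrite [X in tsum X F]/GRing.add /= [in LHS]/GRing.scale /=.
rewrite tensor_pi_scale tensor_pi_cat !tsum_pi // big_cat /=; congr (_ + _).
rewrite big_map scaler_sumr; apply: eq_bigr => -[u v] _ /=.
exact: (linearZZ (mk_linear (bilF.1 v)) a u).
Qed.

Lemma lin_tsum (t : U ⨂ V) (F : X -> U -> V -> W) :
  (forall u v, linear (fun x => F x u v)) -> linear (fun x => tsum t (F x)).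
Proof. by move=> linF; apply: lin_sum => -[u v]; apply: linF. Qed.

Lemma lin_tsum_arg (F : U -> V -> W) (G : X -> U ⨂ V) :
  bilinearf F -> linear G -> linear (fun x => tsum (G x) F).
Proof. by move=> bilF linG a x y; rewrite linG tsum_linear. Qed.

Definition tlift (F : U -> V -> W) (bilF : bilinearf F) : {linear U ⨂ V -> W} :=
  mk_linear (tsum_linear bilF).

Lemma tliftE (F : U -> V -> W) (bilF : bilinearf F) u v :
  tlift bilF (u ⊗ v) = F u v.
Proof. exact: tsum_tens. Qed.

Lemma tlift_unique (f g : {linear U ⨂ V -> W}) :
  (forall u v, f (u ⊗ v) = g (u ⊗ v)) -> f = g.
Proof.
move=> fg; apply: lmapP => t; rewrite [t]tensor_sumE !linear_sum.
by apply: eq_bigr => p _.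
Qed.
End TensorSum.

Notation "'\sw_' ( a , b <- t ) E" := (tsum t (fun a b => E)) : ring_scope.
Notation "'\sw_' ( a , b , c <- t ) E" :=
  (tsum t (fun a s => tsum s (fun b c => E))) : ring_scope.

Lemma lin_tens_l (k : comNzRingType) (U V W : lmodType k) (F : U -> V)
  (w : W) : linear F -> linear (fun x => F x ⊗ w).
Proof. by move=> linF; apply: lin_bil_l linF; apply: tens_bilinear. Qed.

Lemma lin_tens_r (k : comNzRingType) (U V W : lmodType k) (F : U -> V)
  (w : W) : linear F -> linear (fun x => w ⊗ F x).
Proof. by move=> linF; apply: lin_bil_r linF; apply: tens_bilinear. Qed.

Ltac lin := first
  [ split=> ? /=; lin
  | exact: lin_id
  | exact: lin_map
  | done
  | apply: lin_add; lin
  | apply: lin_opp; lin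
  | apply: lin_pair; lin
  | apply: lin_mull; lin
  | apply: lin_mulr; lin
  | apply: lin_tens_l; lin
  | apply: lin_tens_r; lin
  | apply: lin_tsum => ? ? /=; lin
  | apply: lin_tsum_arg; lin
  | apply: lin_scalar; lin
  | apply: lin_scale; lin
  | apply: lin_fst; lin
  | apply: lin_snd; lin
  | apply: lin_comp; lin
  | apply: lin_eval; lin ].

Section TensorMaps.
Variables (k : comNzRingType).

Fact tmap_bilinear (U U' V V' : lmodType k) (f : {linear U -> U'})
  (g : {linear V -> V'}) : bilinearf (fun u v => f u ⊗ g v).
Proof. lin. Qed.
Definition tmap (U U' V V' : lmodType k) (f : {linear U -> U'})
  (g : {linear V -> V'}) : {linear U ⨂ V -> U' ⨂ V'} :=
  tlift (tmap_bilinear f g).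

Variables U V W : lmodType k.

Fact tassoc_bilinear :
  bilinearf (fun (s : U ⨂ V) (w : W) => \sw_(u, v <- s) u ⊗ v ⊗ w).
Proof. lin. Qed.
Definition tassoc : {linear (U ⨂ V) ⨂ W -> U ⨂ (V ⨂ W)} :=
  tlift tassoc_bilinear.

Fact tassocV_bilinear :
  bilinearf (fun (u : U) (s : V ⨂ W) => \sw_(v, w <- s) (u ⊗ v) ⊗ w).
Proof. lin. Qed.
Definition tassocV : {linear U ⨂ (V ⨂ W) -> (U ⨂ V) ⨂ W} :=
  tlift tassocV_bilinear.
End TensorMaps.
Notation "f ⊠ g" := (tmap f g) : ring_scope.

Section TensorMapsTheory.
Variables (k : comNzRingType).

Lemma tmapE (U U' V V' : lmodType k) (f : {linear U -> U'})
  (g : {linear V -> V'}) u v : (f ⊠ g) (u ⊗ v) = f u ⊗ g v.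
Proof. exact: tliftE. Qed.

Variables U V W X : lmodType k.

Lemma tassocE (u : U) (v : V) (w : W) :
  tassoc U V W ((u ⊗ v) ⊗ w) = u ⊗ (v ⊗ w).
Proof. by rewrite tliftE tsum_tens //; lin. Qed.

Lemma tassocVE (u : U) (v : V) (w : W) :
  tassocV U V W (u ⊗ (v ⊗ w)) = (u ⊗ v) ⊗ w.
Proof. by rewrite tliftE tsum_tens //; lin. Qed.

Lemma tlift_unique3 (f g : {linear U ⨂ (V ⨂ W) -> X}) :
  (forall u v w, f (u ⊗ (v ⊗ w)) = g (u ⊗ (v ⊗ w))) -> f = g.
Proof.
move=> fg; apply: tlift_unique => u t.
have linu (h : {linear U ⨂ (V ⨂ W) -> X}) : linear (fun s => h (u ⊗ s)) by lin.
suff E : mk_linear (linu f) = mk_linear (linu g).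
  exact: (congr1 (fun h : {linear _ -> _} => h t) E).
by apply: tlift_unique => v w; apply: fg.
Qed.
End TensorMapsTheory.

Arguments tassoc {k U V W}.
Arguments tassocV {k U V W}.

Fact lcomp_bilinear (k : comNzRingType) (U V W : lmodType k) :
  bilinearf (@lcomp k U V W).
Proof.
split=> [f a g h|g a f h]; apply: lmapP => x //=.
exact: (linearP g).
Qed.

Fact tmap_bilin (k : comNzRingType) (U U' V V' : lmodType k) :
  bilinearf (@tmap k U U' V V').
Proof.
split=> [g a f h|f a g h]; apply: tlift_unique => u v;
  rewrite lmapDE lmapZE !tliftE lmapDE lmapZE.
  exact: tens_linear_l.
exact: tens_linear_r.
Qed.

Section LinearClosureMaps.
Variables (k : comNzRingType) (X U U' V V' W : lmodType k).

Lemma lin_lcomp_l (F : X -> {linear V -> W}) (f : {linear U -> V}) :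
  linear F -> linear (fun x => F x ∘ f).
Proof. by move=> linF; apply: lin_bil_l linF; apply: lcomp_bilinear. Qed.

Lemma lin_lcomp_r (g : {linear V -> W}) (F : X -> {linear U -> V}) :
  linear F -> linear (fun x => g ∘ F x).
Proof. by move=> linF; apply: lin_bil_r linF; apply: lcomp_bilinear. Qed.

Lemma lin_tmap_l (F : X -> {linear U -> U'}) (g : {linear V -> V'}) :
  linear F -> linear (fun x => F x ⊠ g).
Proof. by move=> linF; apply: lin_bil_l linF; apply: tmap_bilin. Qed.

Lemma lin_tmap_r (f : {linear U -> U'}) (F : X -> {linear V -> V'}) :
  linear F -> linear (fun x => f ⊠ F x).
Proof. by move=> linF; apply: lin_bil_r linF; apply: tmap_bilin. Qed.
End LinearClosureMaps.

Ltac linmap := first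
  [ exact: lin_id
  | exact: lin_map
  | apply: lin_add; linmap
  | apply: lin_opp; linmap
  | apply: lin_pair; linmap
  | apply: lin_lcomp_l; linmap
  | apply: lin_lcomp_r; linmap
  | apply: lin_tmap_l; linmap
  | apply: lin_tmap_r; linmap
  | apply: lin_fst; linmap
  | apply: lin_snd; linmap ].

(* The cochain groups and differentials of a braided algebra (V, mu, R) depend
   only on V, mu and R: neither the invertibility of R nor the braided algebra
   axioms enter the formulas, so they are not required here.
   V^{⊗3} is encoded as V ⨂ (V ⨂ V).  On it f ⊗ 1 is op12 f or con12 f, and
   1 ⊗ f is op23 f or con23 f, according as f takes values in V^{⊗2} or V. *)

Section YBH.
Variables (k : comNzRingType) (V : lmodType k).
Variables (mu : {linear V ⨂ V -> V}) (R : {linear V ⨂ V -> V ⨂ V}).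

Definition op12 (f : {linear V ⨂ V -> V ⨂ V}) :
    {linear V ⨂ (V ⨂ V) -> V ⨂ (V ⨂ V)} :=
  tassoc ∘ (f ⊠ lid) ∘ tassocV.
Definition con12 (f : {linear V ⨂ V -> V}) : {linear V ⨂ (V ⨂ V) -> V ⨂ V} :=
  (f ⊠ lid) ∘ tassocV.

Definition op23 (f : {linear V ⨂ V -> V ⨂ V}) :
    {linear V ⨂ (V ⨂ V) -> V ⨂ (V ⨂ V)} :=
  lid ⊠ f.
Definition con23 (f : {linear V ⨂ V -> V}) : {linear V ⨂ (V ⨂ V) -> V ⨂ V} :=
  lid ⊠ f.

Local Notation C2_H := {linear V ⨂ V -> V}.
Local Notation C2_YBH := ({linear V ⨂ V -> V ⨂ V} * {linear V ⨂ V -> V})%type.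

Definition delta1_YB (f : {linear V -> V}) : {linear V ⨂ V -> V ⨂ V} :=
  R ∘ (f ⊠ lid) + R ∘ (lid ⊠ f) - (f ⊠ lid) ∘ R - (lid ⊠ f) ∘ R.

Definition delta1_H_fun (f : {linear V -> V}) : C2_H :=
  mu ∘ (f ⊠ lid) + mu ∘ (lid ⊠ f) - f ∘ mu.

Definition delta1_YBH_fun (f : {linear V -> V}) : C2_YBH :=
  (delta1_YB f, delta1_H_fun f).

Definition delta2_YB (phi : {linear V ⨂ V -> V ⨂ V}) :
    {linear V ⨂ (V ⨂ V) -> V ⨂ (V ⨂ V)} :=
  op12 R ∘ op23 R ∘ op12 phi + op12 R ∘ op23 phi ∘ op12 R
  + op12 phi ∘ op23 R ∘ op12 R - op23 R ∘ op12 R ∘ op23 phi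
  - op23 R ∘ op12 phi ∘ op23 R - op23 phi ∘ op12 R ∘ op23 R.

Definition delta2_H_fun (psi : C2_H) : {linear V ⨂ (V ⨂ V) -> V} :=
  mu ∘ con12 psi + psi ∘ con12 mu - mu ∘ con23 psi - psi ∘ con23 mu.

Definition delta2_YI (c : C2_YBH) : {linear V ⨂ (V ⨂ V) -> V ⨂ V} :=
  let: (phi, psi) := c in
  con23 psi ∘ op12 R ∘ op23 R + con23 mu ∘ op12 phi ∘ op23 R
  + con23 mu ∘ op12 R ∘ op23 phi - R ∘ con12 psi - phi ∘ con12 mu.

Definition delta2_IY (c : C2_YBH) : {linear V ⨂ (V ⨂ V) -> V ⨂ V} :=
  let: (phi, psi) := c in
  con12 psi ∘ op23 R ∘ op12 R + con12 mu ∘ op23 phi ∘ op12 R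
  + con12 mu ∘ op23 R ∘ op12 phi - R ∘ con23 psi - phi ∘ con23 mu.

Local Notation C3_YBH :=
  ({linear V ⨂ (V ⨂ V) -> V ⨂ (V ⨂ V)} * {linear V ⨂ (V ⨂ V) -> V ⨂ V}
   * {linear V ⨂ (V ⨂ V) -> V ⨂ V} * {linear V ⨂ (V ⨂ V) -> V})%type.

Definition delta2_YBH_fun (c : C2_YBH) : C3_YBH :=
  (delta2_YB c.1, delta2_YI c, delta2_IY c, delta2_H_fun c.2).

Fact delta1_H_linear : linear delta1_H_fun.
Proof. rewrite /delta1_H_fun; linmap. Qed.
Fact delta1_YBH_linear : linear delta1_YBH_fun.
Proof. rewrite /delta1_YBH_fun /delta1_H_fun /delta1_YB; linmap. Qed.
Fact delta2_H_linear : linear delta2_H_fun.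
Proof. rewrite /delta2_H_fun /con12 /con23; linmap. Qed.
Fact delta2_YI_linear : linear delta2_YI.
Proof.
rewrite (_ : delta2_YI = fun c : C2_YBH =>
  con23 c.2 ∘ op12 R ∘ op23 R + con23 mu ∘ op12 c.1 ∘ op23 R
  + con23 mu ∘ op12 R ∘ op23 c.1 - R ∘ con12 c.2 - c.1 ∘ con12 mu).
  rewrite /con12 /con23 /op12 /op23; linmap.
by apply/funext => -[].
Qed.
Fact delta2_IY_linear : linear delta2_IY.
Proof.
rewrite (_ : delta2_IY = fun c : C2_YBH =>
  con12 c.2 ∘ op23 R ∘ op12 R + con12 mu ∘ op23 c.1 ∘ op12 R
  + con12 mu ∘ op23 R ∘ op12 c.1 - R ∘ con23 c.2 - c.1 ∘ con23 mu).
  rewrite /con12 /con23 /op12 /op23; linmap.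
by apply/funext => -[].
Qed.
Fact delta2_YBH_linear : linear delta2_YBH_fun.
Proof.
apply: lin_pair; last first.
  by move=> a x y; apply: delta2_H_linear.
apply: lin_pair; last exact: delta2_IY_linear.
apply: lin_pair; last exact: delta2_YI_linear.
rewrite /delta2_YB /op12 /op23; linmap.
Qed.

Definition delta1_H : {linear {linear V -> V} -> C2_H} :=
  mk_linear delta1_H_linear.
Definition delta1_YBH : {linear {linear V -> V} -> C2_YBH} :=
  mk_linear delta1_YBH_linear.
Definition delta2_H : {linear C2_H -> {linear V ⨂ (V ⨂ V) -> V}} :=
  mk_linear delta2_H_linear.
Definition delta2_YBH : {linear C2_YBH -> C3_YBH} :=
  mk_linear delta2_YBH_linear.

Definition Z2_H : lmodType k := submod (ker_pred delta2_H).
Definition H2_H : lmodType k :=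
  subquot (ker_pred delta2_H) (im_pred delta1_H).
Definition class_H : {linear Z2_H -> H2_H} := subquot_class _ _.

Definition Z2_YBH : lmodType k := submod (ker_pred delta2_YBH).
Definition H2_YBH : lmodType k :=
  subquot (ker_pred delta2_YBH) (im_pred delta1_YBH).
Definition class_YBH : {linear Z2_YBH -> H2_YBH} := subquot_class _ _.
End YBH.
Arguments class_H {k V mu}.
Arguments class_YBH {k V mu R}.

Section AlgebraTensor.
Variables (k : comNzRingType) (A : algType k).

Fact mulm_bilinear : bilinearf (fun x y : A => x * y).
Proof. lin. Qed.
Definition mulm : {linear A ⨂ A -> A} := tlift mulm_bilinear.

Definition tmul (s t : A ⨂ A) : A ⨂ A :=
  \sw_(a, b <- s) \sw_(c, d <- t) (a * c) ⊗ (b * d).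

Lemma tmul_bilinear : bilinearf tmul.
Proof. rewrite /tmul; lin. Qed.
End AlgebraTensor.
Arguments mulm {k A}.

HB.mixin Record isHopfAlgebra (k : comNzRingType) H of GRing.Algebra k H := {
  comul : {linear H -> H ⨂ H};
  counit : {scalar H};
  antipode : {linear H -> H};
  comulA : forall x : H,
    (lid ⊠ comul) (comul x) = tassoc ((comul ⊠ lid) (comul x));
  comul_counitl : forall x : H, \sw_(a, b <- comul x) counit a *: b = x;
  comul_counitr : forall x : H, \sw_(a, b <- comul x) counit b *: a = x;
  comul1 : comul 1 = 1 ⊗ 1;
  comulM : forall x y : H, comul (x * y) = tmul (comul x) (comul y);
  counit1 : counit 1 = 1;
  counitM : forall x y : H, counit (x * y) = counit x * counit y;
  antipodel : forall x : H,
    \sw_(a, b <- comul x) antipode a * b = counit x *: 1;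
  antipoder : forall x : H,
    \sw_(a, b <- comul x) a * antipode b = counit x *: 1
}.
#[short(type="hopfAlgType")]
HB.structure Definition HopfAlgebra (k : comNzRingType) :=
  {H of GRing.Algebra k H & isHopfAlgebra k H}.

Section HopfCohomology.
Variables (k : comNzRingType) (H : hopfAlgType k).
Implicit Types (x y z : H).

Local Notation Δ := (@comul k H).
Local Notation ε := (@counit k H).
Local Notation S := (@antipode k H).
Local Notation C2_Hf := ({linear H ⨂ H -> H} * {linear H -> H ⨂ H})%type.

Definition comul3 x : H ⨂ (H ⨂ H) := (lid ⊠ Δ) (Δ x).

Fact braiding_bilinear : bilinearf (fun x y =>
  \sw_(y1, y2, y3 <- comul3 y) y1 ⊗ (S y2 * x * y3)).
Proof. rewrite /comul3; lin. Qed.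
Definition hopf_braiding : {linear H ⨂ H -> H ⨂ H} := tlift braiding_bilinear.

(* A pair c = (ξ, ζ).  In the last two clauses H ⊗ k and k ⊗ H are identified
   with H. *)
Record hopf_cocycle (c : C2_Hf) : Prop := HopfCocycle {
  hopf_cocycle_mul : forall x y z,
    c.1 (x ⊗ y) * z + c.1 ((x * y) ⊗ z) =
    x * c.1 (y ⊗ z) + c.1 (x ⊗ (y * z));
  hopf_cocycle_comul : forall x,
    (\sw_(a, b <- Δ x) a ⊗ c.2 b) + (lid ⊠ Δ) (c.2 x) =
    tassoc (\sw_(a, b <- Δ x) c.2 a ⊗ b) + tassoc ((Δ ⊠ lid) (c.2 x));
  hopf_cocycle_compat : forall x y,
    Δ (c.1 (x ⊗ y)) + c.2 (x * y) =
    (\sw_(x1, x2 <- Δ x) \sw_(y1, y2 <- Δ y) (x1 * y1) ⊗ c.1 (x2 ⊗ y2))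
    + (\sw_(x1, x2 <- Δ x) \sw_(y1, y2 <- Δ y) c.1 (x1 ⊗ y1) ⊗ (x2 * y2))
    + tmul (c.2 x) (Δ y) + tmul (Δ x) (c.2 y);
  hopf_cocycle_mul1l : forall x, c.1 (1 ⊗ x) = 0;
  hopf_cocycle_mul1r : forall x, c.1 (x ⊗ 1) = 0;
  hopf_cocycle_counitr : forall x, \sw_(a, b <- c.2 x) ε b *: a = 0;
  hopf_cocycle_counitl : forall x, \sw_(a, b <- c.2 x) ε a *: b = 0
}.

Definition hopf_cocycle_pred : {pred C2_Hf} := fun c => `[< hopf_cocycle c >].

Lemma lin_eq (M N : lmodType k) (F G : M -> N) a c d :
  linear F -> linear G -> F c = G c -> F d = G d ->
  F (a *: c + d) = G (a *: c + d).
Proof. by move=> linF linG Fc Fd; rewrite linF linG Fc Fd. Qed.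

Lemma lin_eq0 (M N : lmodType k) (F G : M -> N) :
  linear F -> linear G -> F 0 = G 0.
Proof.
move=> lF lG.
have -> : F 0 = 0 := linear0 (mk_linear lF).
exact: esym (linear0 (mk_linear lG)).
Qed.

Lemma lin_zero (M N : lmodType k) : linear (fun _ : M => 0 : N).
Proof. by move=> a x y; rewrite scaler0 addr0. Qed.

Ltac split_eq c tac := match goal with |- ?l = ?r =>
  match eval pattern c in l with ?F _ =>
  match eval pattern c in r with ?G _ =>
    change (F c = G c); tac
  end end end.
Ltac linz := rewrite /tmul; first [exact: lin_zero | lin].

Fact hopf_cocycle0 : hopf_cocycle 0.
Proof.
by split=> *; split_eq (0 : C2_Hf) ltac:(apply: lin_eq0); linz.
Qed.

Fact hopf_cocycle_lin a c d :
  hopf_cocycle c -> hopf_cocycle d -> hopf_cocycle (a *: c + d).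
Proof.
move=> [c1 c2 c3 c4 c5 c6 c7] [d1 d2 d3 d4 d5 d6 d7].
split=> *; split_eq (a *: c + d) ltac:(apply: lin_eq); first [done | linz].
Qed.

Fact hopf_cocycle_submod : GRing.subsemimod_closed hopf_cocycle_pred.
Proof.
have Z0 := hopf_cocycle0.
split=> [|a c /asboolP Zc]; last first.
  by apply/asboolP; rewrite -[a *: c]addr0; apply: hopf_cocycle_lin.
split=> [|c d /asboolP Zc /asboolP Zd]; first exact/asboolP.
by apply/asboolP; rewrite -[c]scale1r; apply: hopf_cocycle_lin.
Qed.
HB.instance Definition _ := GRing.isSubmodClosed.Build k C2_Hf
  hopf_cocycle_pred hopf_cocycle_submod.

Definition delta1_Hf_fun (f : {linear H -> H}) : C2_Hf :=
  (mulm ∘ (lid ⊠ f) + mulm ∘ (f ⊠ lid) - f ∘ mulm,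
   Δ ∘ f - (f ⊠ lid + lid ⊠ f) ∘ Δ).
Fact delta1_Hf_linear : linear delta1_Hf_fun.
Proof. rewrite /delta1_Hf_fun; linmap. Qed.
Definition delta1_Hf : {linear {linear H -> H} -> C2_Hf} :=
  mk_linear delta1_Hf_linear.

Definition Z2_Hf : lmodType k := submod hopf_cocycle_pred.
Definition H2_Hf : lmodType k := subquot hopf_cocycle_pred (im_pred delta1_Hf).
Definition class_Hf : {linear Z2_Hf -> H2_Hf} := subquot_class _ _.

Fact hopf_cocycle_Hochschild (c : Z2_Hf) :
  (submod_val c).1 \in ker_pred (delta2_H mulm).
Proof.
case: c => c /asboolP /= [cmul _ _ _ _ _ _]; apply/eqP.
apply: tlift_unique3 => x y z /=.
rewrite !(tmapE, tassocVE) /= !tliftE cmul.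
by rewrite addrAC addrK subrr.
Qed.
Definition Hochschild_part (c : Z2_Hf) : Z2_H mulm :=
  SubMod (hopf_cocycle_Hochschild c).

(* The degree-one term of the antipode of the Hopf algebra deformed by
   mu + ħ c.1 and Δ + ħ c.2 *)
Definition antipode' (c : C2_Hf) (x : H) : H :=
  - (\sw_(x1, x2, x3 <- comul3 x) S x1 * c.1 (x2 ⊗ S x3))
  - (\sw_(x1, x2 <- Δ x) S x1 * mulm ((lid ⊠ S) (c.2 x2))).

Fact antipode'_linear c : linear (antipode' c).
Proof. rewrite /antipode' /comul3; lin. Qed.

Definition Psi_fun (c : C2_Hf) (x y : H) : H ⨂ H :=
  let: (xi, zeta) := c in
  (\sw_(y1, y2, y3 <- comul3 y) y1 ⊗ (S y2 * xi (x ⊗ y3)))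
  + (\sw_(y1, y2, y3 <- comul3 y) y1 ⊗ xi (S y2 ⊗ (x * y3)))
  + (\sw_(a, b, d <- (lid ⊠ Δ) (zeta y)) a ⊗ (S b * x * d))
  + (\sw_(a, b, d <- (lid ⊠ zeta) (Δ y)) a ⊗ (S b * x * d))
  + (\sw_(y1, y2, y3 <- comul3 y) y1 ⊗ (antipode' c y2 * x * y3)).

Fact Psi_bilinear c : bilinearf (Psi_fun c).
Proof.
case: c => xi zeta; have Slin := antipode'_linear (xi, zeta).
rewrite /Psi_fun /comul3; lin.
Qed.
Definition Psi (c : C2_Hf) : {linear H ⨂ H -> H ⨂ H} :=
  tlift (Psi_bilinear c).
End HopfCohomology.

Arguments class_Hf {k H}.
Arguments Hochschild_part {k H} c.

(* Main.v *)
Require Import Defs.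
From HB Require Import structures.
From mathcomp Require Import all_boot all_order all_algebra.
From mathcomp Require Import boolp.
Import GRing.Theory.
Local Open Scope ring_scope.
Set Implicit Arguments.
Unset Strict Implicit.
Unset Printing Implicit Defensive.

(** The theorem is the degree-one part, in a parameter ħ with ħ^2 = 0, of facts
    that hold for every Hopf algebra over every commutative ring.

    For any Hopf algebra, R(x ⊗ z) = z1 ⊗ (x ◁ z2) where x ◁ z = S(z1) x z2 is
    the right adjoint action.  This action is determined by the identity
    z1 (x ◁ z2) = x z (mul_adj), because z1 can be cancelled with the help of
    the antipode (action_cancel).  Cancelling in this way shows that ◁ is an
    action (adjA) by which H is a module algebra (adjM) and a Yetter-Drinfeld
    module (adj_yetter_drinfeld); these three facts are respectively what the
    compatibility of R with a product on the right, with a product on the left,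
    and the braid equation amount to (hopf_braiding_con23, hopf_braiding_con12,
    hopf_braiding_braid).  The same cancellation shows that R is natural for
    morphisms of bialgebras (hopf_braiding_morph).

    A normalized Hopf 2-cocycle c = (ξ, ζ) makes H[ħ] a Hopf algebra over the
    dual numbers k[ħ]/(ħ^2), with product μ + ħξ, coproduct Δ + ħζ and antipode
    S + ħS'; this is the type deform.  Its braiding is R + ħΨ(c)
    (lifts_hopf_braiding).  The coefficients of ħ in the braided algebra axioms
    of deform are the equations saying that (Ψ(c), ξ) is a cocycle
    (Psi_cocycle).

    If c is the coboundary of f, then 1 + ħf is a morphism of bialgebras from
    the deformation by c to the trivial deformation, and the coefficient of ħ in
    the naturality of the braiding says that (Ψ(c), ξ) is the coboundary of f
    (Psi_coboundary).  As Ψ is linear in c, it induces a map in cohomology.  The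
    second component of a coboundary of the braided complex is a Hochschild
    coboundary, so that a class mapped to 0 has a trivial Hochschild part.

    To read off coefficients of ħ, modules over the dual numbers are equipped
    with coordinates in some V[ħ] (frame).  A linear map then has a constant
    part f0 and a part of degree one f1 (lifts), for which composition and
    tensor product follow the Leibniz rule (lifts_comp, lifts_tmap). *)

(** * Linear maps and tensor products *)

Lemma lcompE (k : comNzRingType) (U V W : lmodType k) (g : {linear V -> W})
  (f : {linear U -> V}) x : (g ∘ f) x = g (f x).
Proof. by []. Qed.

Lemma eq_lmap (k : comNzRingType) (U V : lmodType k) (f g : {linear U -> V}) :
  f = g -> f =1 g.
Proof. by move->. Qed.

Lemma lidE (k : comNzRingType) (U : lmodType k) x : @lid k U x = x.
Proof. by []. Qed.

Section TensorSumTheory.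
Variables (k : comNzRingType) (U V W X : lmodType k).

Lemma eq_tsum (t : U ⨂ V) (F G : U -> V -> W) :
  (forall a b, F a b = G a b) -> tsum t F = tsum t G.
Proof. by move=> FG; apply: eq_bigr => p _. Qed.

Lemma linear_tsum (f : {linear W -> X}) (t : U ⨂ V) (F : U -> V -> W) :
  f (\sw_(a, b <- t) F a b) = \sw_(a, b <- t) f (F a b).
Proof. exact: linear_sum. Qed.

(** For maps whose linearity is a proof, such as the sections of a multilinear
    expression, rather than a structure. *)
Lemma linear_fun_tsum (f : W -> X) (t : U ⨂ V) (F : U -> V -> W) :
  linear f -> f (\sw_(a, b <- t) F a b) = \sw_(a, b <- t) f (F a b).
Proof. by move=> lf; apply: (linear_tsum (mk_linear lf)). Qed.

Lemma linear_fun_scale (f : W -> X) a w : linear f -> f (a *: w) = a *: f w.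
Proof. by move=> lf; apply: (linearZZ (mk_linear lf)). Qed.

Lemma linear_tensE (f : {linear U ⨂ V -> W}) t :
  f t = \sw_(a, b <- t) f (a ⊗ b).
Proof. by rewrite [in LHS](tensor_sumE t) linear_sum. Qed.

Lemma tsumD (t : U ⨂ V) (F G : U -> V -> W) :
  \sw_(a, b <- t) (F a b + G a b) = tsum t F + tsum t G.
Proof. exact: big_split. Qed.
End TensorSumTheory.

Lemma tsum_tsum (k : comNzRingType) (U V U' V' W : lmodType k) (t : U ⨂ V)
  (F : U -> V -> U' ⨂ V') (G : U' -> V' -> W) : bilinearf G ->
  tsum (tsum t F) G = \sw_(a, b <- t) tsum (F a b) G.
Proof. by move=> bG; apply: (linear_tsum (tlift bG)). Qed.

Lemma tmap_tsumE (k : comNzRingType) (U V U' V' : lmodType k)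
  (f : {linear U -> U'}) (g : {linear V -> V'}) t :
  (f ⊠ g) t = \sw_(a, b <- t) f a ⊗ g b.
Proof. by []. Qed.

Lemma tsum_tmap (k : comNzRingType) (U V U' V' W : lmodType k) (t : U ⨂ V)
  (f : {linear U -> U'}) (g : {linear V -> V'}) (G : U' -> V' -> W) :
  bilinearf G -> tsum ((f ⊠ g) t) G = \sw_(a, b <- t) G (f a) (g b).
Proof.
move=> bG; rewrite linear_tensE tsum_tsum //; apply: eq_tsum => a b.
by rewrite tmapE tsum_tens.
Qed.

Lemma exchange_tsum (k : comNzRingType) (U V U' V' W : lmodType k)
  (s : U ⨂ V) (t : U' ⨂ V') (F : U -> V -> U' -> V' -> W) :
  \sw_(a, b <- s) \sw_(c, d <- t) F a b c d =
  \sw_(c, d <- t) \sw_(a, b <- s) F a b c d.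
Proof. exact: exchange_big. Qed.

Section TensorSumAlgebra.
Variables (k : comNzRingType) (U V : lmodType k) (A : algType k).

Lemma tsum_mull (t : U ⨂ V) (F : U -> V -> A) y :
  tsum t F * y = \sw_(a, b <- t) (F a b * y).
Proof. exact: mulr_suml. Qed.

Lemma tsum_mulr (t : U ⨂ V) (F : U -> V -> A) y :
  y * tsum t F = \sw_(a, b <- t) (y * F a b).
Proof. exact: mulr_sumr. Qed.
End TensorSumAlgebra.

Section TensorSumTens.
Variables (k : comNzRingType) (U V W X : lmodType k).

Lemma tsum_tensl (t : U ⨂ V) (F : U -> V -> W) (y : X) :
  tsum t F ⊗ y = \sw_(a, b <- t) (F a b ⊗ y).
Proof.
pose f := mk_linear (@lin_tens_l k W W X id y (@lin_id _ _)).
exact: (linear_tsum f).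
Qed.

Lemma tsum_tensr (t : U ⨂ V) (F : U -> V -> W) (y : X) :
  y ⊗ tsum t F = \sw_(a, b <- t) (y ⊗ F a b).
Proof.
pose f := mk_linear (@lin_tens_r k W W X id y (@lin_id _ _)).
exact: (linear_tsum f).
Qed.
End TensorSumTens.

Lemma tensDl (k : comNzRingType) (U V : lmodType k) (u u' : U) (v : V) :
  (u + u') ⊗ v = u ⊗ v + u' ⊗ v.
Proof. exact: (linearD (mk_linear (@tens_linear_l k U V v))). Qed.
Lemma tensZl (k : comNzRingType) (U V : lmodType k) a (u : U) (v : V) :
  (a *: u) ⊗ v = a *: (u ⊗ v).
Proof. exact: (linearZZ (mk_linear (@tens_linear_l k U V v))). Qed.
Lemma tensDr (k : comNzRingType) (U V : lmodType k) (u : U) (v v' : V) :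
  u ⊗ (v + v') = u ⊗ v + u ⊗ v'.
Proof. exact: (linearD (mk_linear (@tens_linear_r k U V u))). Qed.
Lemma tensZr (k : comNzRingType) (U V : lmodType k) a (u : U) (v : V) :
  u ⊗ (a *: v) = a *: (u ⊗ v).
Proof. exact: (linearZZ (mk_linear (@tens_linear_r k U V u))). Qed.
Lemma tens0l (k : comNzRingType) (U V : lmodType k) (v : V) :
  (0 : U) ⊗ v = 0.
Proof. exact: (linear0 (mk_linear (@tens_linear_l k U V v))). Qed.
Lemma tens0r (k : comNzRingType) (U V : lmodType k) (u : U) :
  u ⊗ (0 : V) = 0.
Proof. exact: (linear0 (mk_linear (@tens_linear_r k U V u))). Qed.

Lemma tlift_unique3l (k : comNzRingType) (U V W X : lmodType k)
  (f g : {linear (U ⨂ V) ⨂ W -> X}) :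
  (forall u v w, f ((u ⊗ v) ⊗ w) = g ((u ⊗ v) ⊗ w)) -> f = g.
Proof.
move=> fg; apply: tlift_unique => t w.
have linw (h : {linear (U ⨂ V) ⨂ W -> X}) : linear (fun s => h (s ⊗ w)) by lin.
suff E : mk_linear (linw f) = mk_linear (linw g).
  exact: (eq_lmap E).
by apply: tlift_unique => u v; apply: fg.
Qed.

Lemma tlift_unique4 (k : comNzRingType) (U V W X Y : lmodType k)
  (f g : {linear (U ⨂ V) ⨂ (W ⨂ X) -> Y}) :
  (forall u v w x, f ((u ⊗ v) ⊗ (w ⊗ x)) = g ((u ⊗ v) ⊗ (w ⊗ x))) -> f = g.
Proof.
move=> fg; apply: tlift_unique3l => u v t.
have lint (h : {linear (U ⨂ V) ⨂ (W ⨂ X) -> Y}) :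
  linear (fun t => h ((u ⊗ v) ⊗ t)) by lin.
suff E : mk_linear (lint f) = mk_linear (lint g).
  exact: (eq_lmap E).
by apply: tlift_unique => w x; apply: fg.
Qed.

Section LinearMapAlgebra.
Variables (k : comNzRingType) (U V W U' V' : lmodType k).

Lemma lcomp0l (f : {linear U -> V}) : (0 : {linear V -> W}) ∘ f = 0.
Proof. exact: lmapP. Qed.
Lemma lcomp0r (g : {linear V -> W}) : g ∘ (0 : {linear U -> V}) = 0.
Proof. by apply: lmapP => x; rewrite lcompE linear0. Qed.
Lemma tmap0l (g : {linear V -> V'}) : (0 : {linear U -> U'}) ⊠ g = 0.
Proof. by apply: tlift_unique => u v; rewrite tmapE tens0l. Qed.
Lemma tmap0r (f : {linear U -> U'}) : f ⊠ (0 : {linear V -> V'}) = 0.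
Proof. by apply: tlift_unique => u v; rewrite tmapE tens0r. Qed.
Lemma lcompDl (g g' : {linear V -> W}) (f : {linear U -> V}) :
  (g + g') ∘ f = g ∘ f + g' ∘ f.
Proof. exact: lmapP. Qed.
Lemma lcompDr (g : {linear V -> W}) (f f' : {linear U -> V}) :
  g ∘ (f + f') = g ∘ f + g ∘ f'.
Proof. by apply: lmapP => x; rewrite !(lmapDE, lcompE) linearD. Qed.
Lemma lcomp1l (f : {linear U -> V}) : lid ∘ f = f.
Proof. exact: lmapP. Qed.
Lemma lcomp1r (f : {linear U -> V}) : f ∘ lid = f.
Proof. exact: lmapP. Qed.
Lemma tmap_lid : @lid k U ⊠ @lid k V = lid.
Proof. by apply: tlift_unique => u v; rewrite tmapE. Qed.
End LinearMapAlgebra.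
Definition lmap_simp := (tmap0l, tmap0r, lcomp0l, lcomp0r, @add0r, @addr0).

Lemma tmap_cancel (k : comNzRingType) (U U' V V' : lmodType k)
  (f : {linear U -> V}) (f' : {linear V -> U})
  (g : {linear U' -> V'}) (g' : {linear V' -> U'}) :
  cancel f f' -> cancel g g' -> cancel (f ⊠ g) (f' ⊠ g').
Proof.
move=> fK gK t.
suff E : (f' ⊠ g') ∘ (f ⊠ g) = lid.
  exact: (eq_lmap E).
by apply: tlift_unique => u v; rewrite lcompE !tmapE fK gK.
Qed.

Lemma mulmE (k : comNzRingType) (A : algType k) (x y : A) :
  mulm (x ⊗ y) = x * y.
Proof. exact: tliftE. Qed.

Lemma mulm_tmap (k : comNzRingType) (U V : lmodType k) (A : algType k)
  (f : {linear U -> A}) (g : {linear V -> A}) t :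
  mulm ((f ⊠ g) t) = \sw_(a, b <- t) (f a * g b).
Proof.
rewrite tmap_tsumE (linear_tsum mulm); apply: eq_tsum => a b; exact: mulmE.
Qed.

Section TensorAlgebra.
Variables (k : comNzRingType) (A : algType k).

Lemma tmul_tens (a b d e : A) : tmul (a ⊗ b) (d ⊗ e) = (a * d) ⊗ (b * e).
Proof. by rewrite /tmul !tsum_tens //; lin. Qed.

Lemma tmulr1 (t : A ⨂ A) : tmul t (1 ⊗ 1) = t.
Proof.
rewrite /tmul [RHS]tensor_sumE; apply: eq_bigr => p _.
by rewrite tsum_tens ?mulr1 //; lin.
Qed.

Lemma tmul1r (t : A ⨂ A) : tmul (1 ⊗ 1) t = t.
Proof.
rewrite /tmul tsum_tens; last by lin.
by rewrite [RHS]tensor_sumE; apply: eq_bigr => p _; rewrite !mul1r.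
Qed.
End TensorAlgebra.

Section OpPure.
Variables (k : comNzRingType) (V : lmodType k).

Lemma op12E (f : {linear V ⨂ V -> V ⨂ V}) u v w :
  op12 f (u ⊗ (v ⊗ w)) = \sw_(p, q <- f (u ⊗ v)) p ⊗ (q ⊗ w).
Proof. by rewrite /op12 !lcompE tassocVE tmapE; exact: tliftE. Qed.

Lemma op23E (f : {linear V ⨂ V -> V ⨂ V}) u s : op23 f (u ⊗ s) = u ⊗ f s.
Proof. exact: tmapE. Qed.

Lemma con12E (f : {linear V ⨂ V -> V}) u v w :
  con12 f (u ⊗ (v ⊗ w)) = f (u ⊗ v) ⊗ w.
Proof. by rewrite /con12 lcompE tassocVE tmapE. Qed.

Lemma con23E (f : {linear V ⨂ V -> V}) u s : con23 f (u ⊗ s) = u ⊗ f s.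
Proof. exact: tmapE. Qed.
End OpPure.

Section SwapLeft.
Variables (k : comNzRingType) (U V W : lmodType k).

Fact swapl_bilinear : bilinearf (fun (u : U) (s : V ⨂ W) =>
  \sw_(v, w <- s) v ⊗ (u ⊗ w)).
Proof. lin. Qed.
Definition swapl : {linear U ⨂ (V ⨂ W) -> V ⨂ (U ⨂ W)} := tlift swapl_bilinear.
Lemma swapl_tsumE u s : swapl (u ⊗ s) = \sw_(v, w <- s) v ⊗ (u ⊗ w).
Proof. exact: tliftE. Qed.
Lemma swaplE u v w : swapl (u ⊗ (v ⊗ w)) = v ⊗ (u ⊗ w).
Proof. by rewrite swapl_tsumE tsum_tens //; lin. Qed.
End SwapLeft.
Arguments swapl {k U V W}.

Section Sandwich.
Variables (k : comNzRingType) (V : lmodType k).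

(** x ⊗ (a ⊗ (b ⊗ d)) is sent to a ⊗ m (b ⊗ (x ⊗ d)).  On x ⊗ y1 ⊗ y2 ⊗ y3 this
    is the shape of the braiding of a Hopf algebra, with m depending on the
    product and on the antipode only. *)
Definition sandwich (m : {linear V ⨂ (V ⨂ V) -> V}) :
    {linear V ⨂ (V ⨂ (V ⨂ V)) -> V ⨂ V} :=
  (lid ⊠ m) ∘ ((lid ⊠ swapl) ∘ swapl).

Lemma sandwichE m x t :
  sandwich m (x ⊗ t) = \sw_(a, b, d <- t) a ⊗ m (b ⊗ (x ⊗ d)).
Proof.
rewrite /sandwich [LHS]lcompE [X in (lid ⊠ m) X]lcompE swapl_tsumE.
rewrite (linear_tsum (lid ⊠ swapl)) (linear_tsum (lid ⊠ m)).
apply: eq_tsum => a s.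
rewrite !tmapE swapl_tsumE (linear_tsum m) tsum_tensr.
by [].
Qed.
End Sandwich.

(** * Sweedler calculus *)

Definition trilinear (k : comNzRingType) (U V W X : lmodType k)
    (F : U -> V -> W -> X) : Prop :=
  [/\ forall b c, linear (fun a => F a b c),
      forall a c, linear (fun b => F a b c) & forall a b, linear (F a b)].

Ltac trilin := split=> ? ? /=; lin.

(** Stated for any coassociative map, because it is used for the deformed
    coproduct before the antipode axioms are available. *)
Lemma coassoc_tsum (k : comNzRingType) (V W : lmodType k)
  (D : {linear V -> V ⨂ V}) x (F : V -> V -> V -> W) :
  (lid ⊠ D) (D x) = tassoc ((D ⊠ lid) (D x)) -> trilinear F ->
  \sw_(a, b <- D x) \sw_(c, d <- D b) F a c d =
  \sw_(a, b <- D x) \sw_(c, d <- D a) F c d b.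
Proof.
move=> DA [F1 F2 F3].
have bF a : bilinearf (F a) by split=> b; [apply: F2|apply: F3].
have bG : bilinearf (fun a s => tsum s (F a)).
  split=> [s|a] /=; last exact: tsum_linear.
  by apply: lin_tsum => b c.
have := congr1 (fun t => tsum t (fun a s => tsum s (F a))) DA.
rewrite tsum_tmap // => ->.
rewrite (linear_tensE tassoc) tsum_tsum // tsum_tmap; last first.
  by split=> a /=; apply: lin_tsum_arg => //; lin.
apply: eq_tsum => a b; rewrite tliftE tsum_tsum //.
by apply: eq_tsum => c d; rewrite !tsum_tens.
Qed.

Section Sweedler.
Variables (k : comNzRingType) (H : hopfAlgType k) (W : lmodType k).
Implicit Types x y z : H.
Local Notation Δ := (@comul k H).
Local Notation ε := (@counit k H).
Local Notation S := (@antipode k H).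

Lemma sweedlerA x (F : H -> H -> H -> W) : trilinear F ->
  \sw_(a, b <- Δ x) \sw_(c, d <- Δ b) F a c d =
  \sw_(a, b <- Δ x) \sw_(c, d <- Δ a) F c d b.
Proof. exact/coassoc_tsum/comulA. Qed.

Lemma sweedler_counitl x (F : H -> W) : linear F ->
  \sw_(a, b <- Δ x) (ε a *: F b) = F x.
Proof.
move=> lF; rewrite -[in RHS](comul_counitl x) linear_fun_tsum //.
by apply: eq_tsum => a b; rewrite linear_fun_scale.
Qed.

Lemma sweedler_counitr x (F : H -> W) : linear F ->
  \sw_(a, b <- Δ x) (ε b *: F a) = F x.
Proof.
move=> lF; rewrite -[in RHS](comul_counitr x) linear_fun_tsum //.
by apply: eq_tsum => a b; rewrite linear_fun_scale.
Qed.

Lemma tsum_comulM x y (F : H -> H -> W) : bilinearf F ->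
  tsum (Δ (x * y)) F =
  \sw_(a, b <- Δ x) \sw_(c, d <- Δ y) F (a * c) (b * d).
Proof.
move=> bF; rewrite comulM /tmul tsum_tsum //; apply: eq_tsum => a b.
by rewrite tsum_tsum //; apply: eq_tsum => c d; rewrite tsum_tens.
Qed.

Lemma sweedler_antipodel x (B : H -> H -> W) : bilinearf B ->
  \sw_(a, b <- Δ x) \sw_(c, d <- Δ a) B (S c * d) b = B 1 x.
Proof.
move=> [B1 B2]; transitivity (\sw_(a, b <- Δ x) (ε a *: B 1 b)); last first.
  by rewrite sweedler_counitl.
apply: eq_tsum => a b; rewrite -(linear_fun_tsum _ _ (B1 b)) antipodel.
exact: (linear_fun_scale _ _ (B1 b)).
Qed.

Lemma sweedler_antipoder x (B : H -> H -> W) : bilinearf B ->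
  \sw_(a, b <- Δ x) \sw_(c, d <- Δ a) B (c * S d) b = B 1 x.
Proof.
move=> [B1 B2]; transitivity (\sw_(a, b <- Δ x) (ε a *: B 1 b)); last first.
  by rewrite sweedler_counitl.
apply: eq_tsum => a b; rewrite -(linear_fun_tsum _ _ (B1 b)) antipoder.
exact: (linear_fun_scale _ _ (B1 b)).
Qed.
End Sweedler.

(** * The right adjoint action *)

Section Adjoint.
Variables (k : comNzRingType) (H : hopfAlgType k).
Implicit Types x y z : H.
Local Notation Δ := (@comul k H).
Local Notation ε := (@counit k H).
Local Notation S := (@antipode k H).

(** S(z1) undoes z2: by coassociativity the two meet as S(z1) z2. *)
Lemma action_antipodeK (M : lmodType k) (act : H -> M -> M) (F : H -> M) z :
  bilinearf act -> (forall m, act 1 m = m) ->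
  (forall a b m, act (a * b) m = act a (act b m)) -> linear F ->
  \sw_(a, b <- Δ z) act (S a) (\sw_(c, d <- Δ b) act c (F d)) = F z.
Proof.
move=> bA act1 actM lF.
have bAF : bilinearf (fun a b => act a (F b)).
  by split=> [b|a] /=; [apply: bA.1|apply: lin_bil_r bA lF].
transitivity (\sw_(a, b <- Δ z) \sw_(c, d <- Δ b) act (S a * c) (F d)).
  apply: eq_tsum => a b; rewrite linear_fun_tsum; last exact: bA.2.
  by apply: eq_tsum => c d; rewrite actM.
rewrite (@sweedlerA k H M z (fun a c d => act (S a * c) (F d))); last first.
  split=> ? ? /=; last exact: bAF.2.
    by apply: (lin_bil_l _ bA); lin.
  by apply: (lin_bil_l _ bA); lin.
by rewrite (@sweedler_antipodel k H M z (fun a b => act a (F b))) ?act1.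
Qed.

(** The cancellation principle from which every property of the adjoint action
    is derived: F is determined by the sums of the z1 F(z2). *)
Lemma action_cancel (M : lmodType k) (act : H -> M -> M) (F G : H -> M) :
  bilinearf act -> (forall m, act 1 m = m) ->
  (forall a b m, act (a * b) m = act a (act b m)) -> linear F -> linear G ->
  (forall z, \sw_(a, b <- Δ z) act a (F b) = \sw_(a, b <- Δ z) act a (G b)) ->
  F =1 G.
Proof.
move=> bA act1 actM lF lG FG z.
rewrite -(action_antipodeK z bA act1 actM lF).
rewrite -[RHS](action_antipodeK z bA act1 actM lG).
by apply: eq_tsum => a b; rewrite FG.
Qed.

Lemma mul_cancel (F G : H -> H) : linear F -> linear G ->
  (forall z, \sw_(a, b <- Δ z) (a * F b) = \sw_(a, b <- Δ z) (a * G b)) ->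
  F =1 G.
Proof.
by apply: action_cancel => [|m|a b m]; [lin|apply: mul1r|rewrite mulrA].
Qed.

Lemma mul_antipodeK (F : H -> H) z : linear F ->
  \sw_(a, b <- Δ z) (a * (\sw_(d, e <- Δ b) (S d * F e))) = F z.
Proof.
move=> lF.
under eq_tsum => a b do rewrite tsum_mulr.
rewrite (@sweedlerA k H H z (fun a d e => a * (S d * F e))); last first.
  by split=> ? ? /=; try lin; do 2!apply: lin_mulr.
transitivity (\sw_(a, b <- Δ z) \sw_(d, e <- Δ a) (d * S e * F b)).
  by do 2!apply: eq_tsum => ? ?; rewrite mulrA.
rewrite (@sweedler_antipoder k H H z (fun u b => u * F b)) ?mul1r //.
by split=> ? /=; [lin|apply: lin_mulr].
Qed.

Definition adj x z : H := \sw_(a, b <- Δ z) (S a * x * b).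

Fact adj_bilinear : bilinearf adj.
Proof. rewrite /adj; lin. Qed.

(** The identity that characterizes the adjoint action, as z1 S(z2) = ε(z). *)
Lemma mul_adj x z : \sw_(a, b <- Δ z) (a * adj x b) = x * z.
Proof.
transitivity (\sw_(a, b <- Δ z) \sw_(c, d <- Δ b) (a * S c * (x * d))).
  apply: eq_tsum => a b; rewrite tsum_mulr; apply: eq_tsum => c d.
  by rewrite !mulrA.
rewrite (@sweedlerA k H H z (fun a c d => a * S c * (x * d))); last by trilin.
rewrite (@sweedler_antipoder k H H z (fun u b => u * (x * b))) ?mul1r //; lin.
Qed.

(** After multiplication by z1 on the left both sides become x y z. *)
Lemma adjM x y z : adj (x * y) z = \sw_(a, b <- Δ z) (adj x a * adj y b).
Proof.
move: z; apply: mul_cancel; [exact: adj_bilinear.2|rewrite /adj; lin|] => z.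
rewrite mul_adj.
under [RHS]eq_tsum do rewrite tsum_mulr.
rewrite (@sweedlerA k H H z (fun a c d => a * (adj x c * adj y d))); last first.
  by rewrite /adj; trilin.
under [RHS]eq_tsum => a b.
  under eq_tsum do rewrite mulrA.
  rewrite -tsum_mull mul_adj -mulrA; over.
by rewrite -tsum_mulr mul_adj mulrA.
Qed.

(** Cancel first y1, then z1: y1 z1 ((x ◁ y2) ◁ z2) and y1 z1 (x ◁ (y2 z2)) are
    both x y z. *)
Lemma adjA x y z : adj (adj x y) z = adj x (y * z).
Proof.
pose F y z := adj (adj x y) z; pose G y z := adj x (y * z).
suff FG y' z' : \sw_(c, d <- Δ z') (c * F y' d) = \sw_(c, d <- Δ z') (c * G y' d).
  by apply: mul_cancel (FG y) z; rewrite /F /G /adj; lin.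
move: y'; apply: mul_cancel; [rewrite /F /adj; lin|rewrite /G /adj; lin|] => y'.
transitivity (x * y' * z').
  under eq_tsum do rewrite mul_adj mulrA.
  by rewrite -tsum_mull mul_adj.
transitivity (\sw_(a, b <- Δ y') \sw_(c, d <- Δ z') (a * c * adj x (b * d))).
  rewrite -(@tsum_comulM k H H y' z' (fun u v => u * adj x v)) ?mul_adj ?mulrA //.
  by rewrite /adj; lin.
by apply: eq_tsum => a b; rewrite tsum_mulr; apply: eq_tsum => c d; rewrite mulrA.
Qed.

(** Acting by z1 on the first tensor factor turns both sides into Δ(y z): on the
    left because Δ(z1 (y ◁ z2)) = Δ(y z), on the right by mul_adj. *)
Lemma adj_yetter_drinfeld y z :
  \sw_(a, b <- Δ z) \sw_(u, v <- Δ (adj y b)) u ⊗ (a * v) =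
  \sw_(c, d <- Δ y) \sw_(a, b <- Δ z) adj c a ⊗ (d * b).
Proof.
(* The action of H on the first factor of H ⨂ H by left multiplication. *)
pose lmulf (a : H) : {linear H -> H} :=
  mk_linear (@lin_mulr k H H a id (@lin_id k H)).
pose act a (m : H ⨂ H) := (lmulf a ⊠ lid) m.
have actE a u v : act a (u ⊗ v) = (a * u) ⊗ v by rewrite /act tmapE.
have actE' a m : act a m = \sw_(u, v <- m) ((a * u) ⊗ v).
  by rewrite /act linear_tensE; apply: eq_tsum => u v; rewrite tmapE.
have bact : bilinearf act.
  split=> m; last exact: linearP.
  have la : linear (fun a => \sw_(u, v <- m) ((a * u) ⊗ v)) by lin.
  by move=> a u v; rewrite !actE' la.
move: z; apply: (action_cancel bact) => [m|a b m|||z].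
- rewrite actE' [RHS]tensor_sumE.
  by apply: eq_bigr => p _; rewrite mul1r.
- by rewrite !actE' tsum_tsum; [|lin]; apply: eq_tsum => u v;
    rewrite tsum_tens ?mulrA //; lin.
- by rewrite /adj; lin.
- by rewrite /adj; lin.
transitivity (Δ (y * z)).
  rewrite -mul_adj linear_tsum.
  transitivity (\sw_(a, b <- Δ z) \sw_(c, d <- Δ b)
      \sw_(u, v <- Δ (adj y d)) (a * u) ⊗ (c * v)).
    apply: eq_tsum => a b; rewrite linear_fun_tsum; last exact: bact.2.
    apply: eq_tsum => c d; rewrite linear_fun_tsum; last exact: bact.2.
    by apply: eq_tsum => u v; rewrite actE.
  rewrite (@sweedlerA k H _ z (fun a c d =>
    \sw_(u, v <- Δ (adj y d)) (a * u) ⊗ (c * v))); last first.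
    by rewrite /adj; trilin.
  by apply: eq_tsum => a b; rewrite comulM.
symmetry.
transitivity (\sw_(a, b <- Δ z) \sw_(c, d <- Δ y) \sw_(u, v <- Δ b)
  (a * adj c u) ⊗ (d * v)).
  apply: eq_tsum => a b; rewrite linear_fun_tsum; last exact: bact.2.
  apply: eq_tsum => c d; rewrite linear_fun_tsum; last exact: bact.2.
  by apply: eq_tsum => u v; rewrite actE.
rewrite exchange_tsum comulM /tmul; apply: eq_tsum => c d.
rewrite (@sweedlerA k H _ z (fun a u v => (a * adj c u) ⊗ (d * v))); last first.
  by rewrite /adj; trilin.
by apply: eq_tsum => a b; rewrite -tsum_tensl mul_adj.
Qed.
End Adjoint.

(** * The braided algebra of a Hopf algebra *)

Section BraidedAlgebra.
Variables (k : comNzRingType) (H : hopfAlgType k).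
Implicit Types x y z : H.
Local Notation Δ := (@comul k H).
Local Notation ε := (@counit k H).
Local Notation S := (@antipode k H).
Local Notation R := (hopf_braiding H).

Lemma hopf_braidingE x z : R (x ⊗ z) = \sw_(a, b <- Δ z) a ⊗ adj x b.
Proof.
rewrite tliftE /comul3 tsum_tmap; last by lin.
by apply: eq_tsum => a b; rewrite tsum_tensr.
Qed.

Lemma op12_hopf_braiding x y z :
  op12 R (x ⊗ (y ⊗ z)) = \sw_(a, b <- Δ y) a ⊗ (adj x b ⊗ z).
Proof.
rewrite op12E hopf_braidingE tsum_tsum; last by lin.
by apply: eq_tsum => a b; rewrite tsum_tens //; lin.
Qed.

Lemma op23_hopf_braiding x y z :
  op23 R (x ⊗ (y ⊗ z)) = \sw_(a, b <- Δ z) x ⊗ (a ⊗ adj y b).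
Proof. by rewrite op23E hopf_braidingE tsum_tensr. Qed.

(** On x ⊗ y ⊗ z the left side is z1 ⊗ (y1 ◁ z2) ⊗ x ◁ (y2 z3), and the right side
    is z1 ⊗ (y ◁ z3)_1 ⊗ x ◁ (z2 (y ◁ z3)_2); they agree by the Yetter-Drinfeld
    condition. *)
Lemma hopf_braiding_braid :
  op12 R ∘ op23 R ∘ op12 R = op23 R ∘ op12 R ∘ op23 R.
Proof.
apply: tlift_unique3 => x y z.
change (op12 R (op23 R (op12 R (x ⊗ (y ⊗ z)))) =
        op23 R (op12 R (op23 R (x ⊗ (y ⊗ z))))).
transitivity (\sw_(e, c <- Δ z) \sw_(a, b <- Δ y) \sw_(f, d <- Δ c)
   e ⊗ (adj a f ⊗ adj x (b * d))).
  rewrite op12_hopf_braiding (linear_tsum (op23 R)) (linear_tsum (op12 R)).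
  under eq_tsum => a b.
    rewrite op23_hopf_braiding linear_tsum.
    under eq_tsum do rewrite op12_hopf_braiding adjA.
    over.
  rewrite [RHS]exchange_tsum; apply: eq_tsum => a b.
  rewrite (@sweedlerA k H _ z (fun e f d => e ⊗ (adj a f ⊗ adj x (b * d)))) //.
  by rewrite /adj; trilin.
transitivity (\sw_(e, c <- Δ z) \sw_(f, d <- Δ c)
   \sw_(u, v <- Δ (adj y d)) e ⊗ (u ⊗ adj x (f * v))).
  apply: eq_tsum => e c.
  (* Apply e ⊗ (1 ⊗ adj x) to the Yetter-Drinfeld condition for y and c. *)
  pose F u v : H ⨂ (H ⨂ H) := e ⊗ (u ⊗ adj x v).
  have bF : bilinearf F by rewrite /F /adj; lin.
  have := congr1 (fun t => tsum t F) (adj_yetter_drinfeld y c).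
  rewrite /= !tsum_tsum // => YD.
  transitivity (\sw_(a, b <- Δ y) tsum (\sw_(c, d <- Δ c) adj a c ⊗ (b * d)) F).
    apply: eq_tsum => a b; rewrite tsum_tsum //; apply: eq_tsum => f d.
    by rewrite tsum_tens.
  rewrite -YD; apply: eq_tsum => f d; rewrite tsum_tsum //.
  by apply: eq_tsum => u v; rewrite tsum_tens.
rewrite op23_hopf_braiding (linear_tsum (op12 R)) (linear_tsum (op23 R)).
rewrite (@sweedlerA k H _ z (fun e f d =>
  \sw_(u, v <- Δ (adj y d)) e ⊗ (u ⊗ adj x (f * v)))); last first.
  by rewrite /adj; trilin.
apply: eq_tsum => c d; rewrite op12_hopf_braiding (linear_tsum (op23 R)).
apply: eq_tsum => e f; rewrite op23_hopf_braiding.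
by apply: eq_tsum => u v; rewrite adjA.
Qed.

Lemma hopf_braiding_con12 : con23 mulm ∘ op12 R ∘ op23 R = R ∘ con12 mulm.
Proof.
apply: tlift_unique3 => x y z.
change (con23 mulm (op12 R (op23 R (x ⊗ (y ⊗ z)))) =
        R (con12 mulm (x ⊗ (y ⊗ z)))).
rewrite op23_hopf_braiding con12E mulmE hopf_braidingE.
rewrite (linear_tsum (op12 R)) (linear_tsum (con23 mulm)).
transitivity (\sw_(c, d <- Δ z) \sw_(a, b <- Δ c) a ⊗ (adj x b * adj y d)).
  apply: eq_tsum => c d; rewrite op12_hopf_braiding linear_tsum.
  by apply: eq_tsum => a b; rewrite con23E mulmE.
rewrite -(@sweedlerA k H _ z (fun a b d => a ⊗ (adj x b * adj y d))).
  by apply: eq_tsum => a b; rewrite adjM tsum_tensr.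
by rewrite /adj; trilin.
Qed.

Lemma hopf_braiding_con23 : con12 mulm ∘ op23 R ∘ op12 R = R ∘ con23 mulm.
Proof.
apply: tlift_unique3 => x y z.
change (con12 mulm (op23 R (op12 R (x ⊗ (y ⊗ z)))) =
        R (con23 mulm (x ⊗ (y ⊗ z)))).
rewrite op12_hopf_braiding con23E mulmE hopf_braidingE.
rewrite (linear_tsum (op23 R)) (linear_tsum (con12 mulm)).
rewrite tsum_comulM; last by rewrite /adj; lin.
apply: eq_tsum => a b; rewrite op23_hopf_braiding linear_tsum.
by apply: eq_tsum => c d; rewrite con12E mulmE adjA.
Qed.
End BraidedAlgebra.

Section BialgebraMorphism.
Variables (k : comNzRingType) (H1 H2 : hopfAlgType k) (g : {linear H1 -> H2}).
Hypothesis gM : forall x y, g (x * y) = g x * g y.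
Hypothesis gcomul : forall x, comul (g x) = (g ⊠ g) (comul x).
Hypothesis gcounit : forall x, counit (g x) = counit x.

(** By mul_adj, g(z1) g(x ◁ z2) = g(x) g(z); multiply by S(g(z1)).  That g
    commutes with the antipodes is not assumed. *)
Lemma adj_morph x z : g (adj x z) = adj (g x) (g z).
Proof.
transitivity (\sw_(a, b <- comul z) \sw_(c, d <- comul a)
  (antipode (g c) * g d * g (adj x b))).
  transitivity (\sw_(a, b <- comul z) counit a *: g (adj x b)).
    by rewrite sweedler_counitl //; rewrite /adj; lin.
  apply: eq_tsum => a b; rewrite -tsum_mull.
  have -> : \sw_(c, d <- comul a) (antipode (g c) * g d) = counit a *: 1.
    rewrite -gcounit -antipodel gcomul tsum_tmap //; lin.
  by rewrite -scalerAl mul1r.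
rewrite -(@sweedlerA k H1 _ z (fun a b d => antipode (g a) * g b * g (adj x d))).
  rewrite /adj gcomul tsum_tmap; last by lin.
  apply: eq_tsum => a b; rewrite -mulrA -gM -[x * b]mul_adj linear_tsum tsum_mulr.
  by apply: eq_tsum => c d; rewrite gM mulrA.
by rewrite /adj; trilin.
Qed.

Lemma hopf_braiding_morph :
  hopf_braiding H2 ∘ (g ⊠ g) = (g ⊠ g) ∘ hopf_braiding H1.
Proof.
apply: tlift_unique => x z.
rewrite [LHS]lcompE [RHS]lcompE tmapE !hopf_braidingE gcomul tsum_tmap.
  by rewrite linear_tsum; apply: eq_tsum => a b; rewrite tmapE adj_morph.
by rewrite /adj; lin.
Qed.
End BialgebraMorphism.

(** * Dual numbers and base change *)

Section DualNumbers.
Variable k : comNzRingType.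

(** The ring k[ħ]/(ħ^2), the pair (a0, a1) standing for a0 + ħ a1. *)
Definition dual := (k * k)%type.
HB.instance Definition _ := GRing.Zmodule.copy dual (k * k)%type.
Implicit Types a b c : dual.

Lemma dualP a b : a.1 = b.1 -> a.2 = b.2 -> a = b.
Proof. by case: a b => [? ?] [? ?] /= -> ->. Qed.

Definition dual_one : dual := (1, 0).
Definition dual_mul a b : dual := (a.1 * b.1, a.1 * b.2 + a.2 * b.1).

Fact dual_mulA : associative dual_mul.
Proof.
move=> [a0 a1] [b0 b1] [c0 c1]; congr (_, _); rewrite /= ?mulrA //.
by rewrite mulrDl mulrDr !mulrA addrA.
Qed.
Fact dual_mulC : commutative dual_mul.
Proof.
move=> [a0 a1] [b0 b1]; congr (_, _); rewrite /= 1?mulrC //.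
by rewrite addrC mulrC [b0 * _]mulrC.
Qed.
Fact dual_mul1 : left_id dual_one dual_mul.
Proof. by move=> [a0 a1]; congr (_, _); rewrite /= ?mul1r // mul0r addr0. Qed.
Fact dual_mulDl : left_distributive dual_mul +%R.
Proof.
move=> [a0 a1] [b0 b1] [c0 c1]; congr (_, _); rewrite /= !mulrDl //.
by rewrite addrACA.
Qed.
Fact dual_one_neq0 : dual_one != 0.
Proof. by apply/eqP => -[] /eqP; rewrite oner_eq0. Qed.
HB.instance Definition _ := GRing.Zmodule_isComNzRing.Build dual
  dual_mulA dual_mulC dual_mul1 dual_mulDl dual_one_neq0.

Lemma dualD1 a b : (a + b).1 = a.1 + b.1. Proof. by []. Qed.
Lemma dualD2 a b : (a + b).2 = a.2 + b.2. Proof. by []. Qed.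
Lemma dualM1 a b : (a * b).1 = a.1 * b.1. Proof. by []. Qed.
Lemma dualM2 a b : (a * b).2 = a.1 * b.2 + a.2 * b.1. Proof. by []. Qed.
Definition dualE := (dualD1, dualD2, dualM1, dualM2).

Definition hbar : dual := (0, 1).
Lemma hbar2 : hbar * hbar = 0.
Proof. by apply: dualP; rewrite !dualE /hbar /= !(mul0r, mulr0, addr0). Qed.
Lemma dual_hbar a : a = ((a.1, 0) : dual) + ((a.2, 0) : dual) * hbar.
Proof.
by apply: dualP; rewrite !dualE /hbar /= ?(mulr0, mul0r, mulr1, addr0, add0r).
Qed.
End DualNumbers.
Arguments hbar {k}.

Section DualModule.
Variables (k : comNzRingType) (V : lmodType k).

(** The module V[ħ] over the dual numbers, the pair (v0, v1) standing for
    v0 + ħ v1. *)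
Definition dualmod := (V * V)%type.
HB.instance Definition _ := GRing.Zmodule.copy dualmod (V * V)%type.
Definition dualmod_scale (a : dual k) (v : dualmod) : dualmod :=
  (a.1 *: v.1, a.1 *: v.2 + a.2 *: v.1).

Fact dualmod_scaleA a b v :
  dualmod_scale a (dualmod_scale b v) = dualmod_scale (a * b) v.
Proof.
case: a b v => [a0 a1] [b0 b1] [v0 v1]; congr (_, _); rewrite /= !scalerA //.
by rewrite scalerDl scalerDr !scalerA addrA.
Qed.
Fact dualmod_scale1 : left_id 1 dualmod_scale.
Proof.
by move=> [v0 v1]; congr (_, _); rewrite /= ?scale1r // scale0r addr0.
Qed.
Fact dualmod_scaleDr : right_distributive dualmod_scale +%R.
Proof.
by move=> [a0 a1] [v0 v1] [w0 w1]; congr (_, _); rewrite /= !scalerDr // addrACA.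
Qed.
Fact dualmod_scaleDl v : {morph dualmod_scale^~ v : a b / a + b}.
Proof.
case: v => v0 v1 [a0 a1] [b0 b1].
by congr (_, _); rewrite /= !scalerDl // addrACA.
Qed.
HB.instance Definition _ := GRing.Zmodule_isLmodule.Build (dual k) dualmod
  dualmod_scaleA dualmod_scale1 dualmod_scaleDr dualmod_scaleDl.

Lemma dualmodP (v w : dualmod) : v.1 = w.1 -> v.2 = w.2 -> v = w.
Proof. by case: v w => [? ?] [? ?] /= -> ->. Qed.

Lemma dualmodD1 (v w : dualmod) : (v + w).1 = v.1 + w.1. Proof. by []. Qed.
Lemma dualmodD2 (v w : dualmod) : (v + w).2 = v.2 + w.2. Proof. by []. Qed.
Lemma dualmodZ1 a (v : dualmod) : (a *: v).1 = a.1 *: v.1. Proof. by []. Qed.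
Lemma dualmodZ2 a (v : dualmod) : (a *: v).2 = a.1 *: v.2 + a.2 *: v.1.
Proof. by []. Qed.
Definition dualmodE := (dualmodD1, dualmodD2, dualmodZ1, dualmodZ2).
End DualModule.
Notation "V '[ħ]'" := (dualmod V) (at level 1, format "V [ħ]") : type_scope.

Section Extension.
Variables (k : comNzRingType) (V W : lmodType k) (f0 f1 : {linear V -> W}).

Definition ext_fun (v : V[ħ]) : W[ħ] := (f0 v.1, f0 v.2 + f1 v.1).
Lemma ext_fun1 v : (ext_fun v).1 = f0 v.1. Proof. by []. Qed.
Lemma ext_fun2 v : (ext_fun v).2 = f0 v.2 + f1 v.1. Proof. by []. Qed.

Fact ext_linear : linear ext_fun.
Proof.
move=> a v w; apply: dualmodP; rewrite !(dualmodE, ext_fun1, ext_fun2) ?linearP //.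
by rewrite !(linearD, linearZ) /= (AC (3*2) ((1*4*2)*(3*5))).
Qed.
(** The map f0 + ħ f1. *)
Definition ext : {linear V[ħ] -> W[ħ]} := mk_linear ext_linear.

Lemma ext1 v : (ext v).1 = f0 v.1. Proof. by []. Qed.
Lemma ext2 v : (ext v).2 = f0 v.2 + f1 v.1. Proof. by []. Qed.
End Extension.

Section ExtensionTheory.
Variables (k : comNzRingType) (U V W : lmodType k).

Lemma ext_inj (f0 f1 g0 g1 : {linear U -> V}) :
  ext f0 f1 =1 ext g0 g1 -> f0 = g0 /\ f1 = g1.
Proof.
move=> fg; split; apply: lmapP => v; have /(congr1 snd) := fg (v, 0).
  by have /(congr1 fst) := fg (v, 0).
by rewrite /= !linear0 !add0r.
Qed.

Lemma ext_comp (g0 g1 : {linear V -> W}) (f0 f1 : {linear U -> V}) v :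
  ext g0 g1 (ext f0 f1 v) = ext (g0 ∘ f0) (g0 ∘ f1 + g1 ∘ f0) v.
Proof.
by apply: dualmodP; rewrite !(ext1, ext2) //= linearD addrA.
Qed.
End ExtensionTheory.

Section Restriction.
Variables (k : comNzRingType) (M : lmodType (dual k)).

(** Restriction of scalars from the dual numbers to k, the target for tlift when
    a map out of a tensor product over k takes values in a module over the dual
    numbers. *)
Definition restr : Type := M.
HB.instance Definition _ := GRing.Zmodule.on restr.
Definition restr_scale (a : k) (m : restr) : restr := ((a, 0) : dual k) *: (m : M).
Fact restr_scaleA a b v : restr_scale a (restr_scale b v) = restr_scale (a * b) v.
Proof.
rewrite /restr_scale scalerA; congr (_ *: _); congr (_, _).
by rewrite /= mulr0 mul0r addr0.
Qed.
Fact restr_scale1 : left_id 1 restr_scale.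
Proof. by move=> v; rewrite /restr_scale scale1r. Qed.
Fact restr_scaleDr : right_distributive restr_scale +%R.
Proof. by move=> a v w; rewrite /restr_scale scalerDr. Qed.
Fact restr_scaleDl v : {morph restr_scale^~ v : a b / a + b}.
Proof.
move=> a b; rewrite /restr_scale -scalerDl; congr (_ *: _); congr (_, _).
by rewrite /= addr0.
Qed.
HB.instance Definition _ := GRing.Zmodule_isLmodule.Build k restr
  restr_scaleA restr_scale1 restr_scaleDr restr_scaleDl.
End Restriction.

Section TensorDual.
Variables (k : comNzRingType) (V W : lmodType k).
Local Notation M := (V[ħ] ⨂ W[ħ]).

Definition tens_dual (v : V[ħ]) (w : W[ħ]) : (V ⨂ W)[ħ] :=
  (v.1 ⊗ w.1, v.1 ⊗ w.2 + v.2 ⊗ w.1).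
Lemma tens_dual1 v w : (tens_dual v w).1 = v.1 ⊗ w.1. Proof. by []. Qed.
Lemma tens_dual2 v w : (tens_dual v w).2 = v.1 ⊗ w.2 + v.2 ⊗ w.1.
Proof. by []. Qed.

Fact tens_dual_bilinear : bilinearf tens_dual.
Proof.
split=> [w|v] a x y; apply: dualmodP;
  rewrite !(dualmodE, tens_dual1, tens_dual2, tensDl, tensDr, tensZl, tensZr) //;
  rewrite scalerDr.
  by rewrite (AC (2*3) ((1*3*4)*(2*5))).
by rewrite (AC (3*2) ((1*4*2)*(3*5))).
Qed.
Definition dual_of_tens : {linear V[ħ] ⨂ W[ħ] -> (V ⨂ W)[ħ]} :=
  tlift tens_dual_bilinear.

Definition cst (V' : lmodType k) (v : V') : V'[ħ] := (v, 0).
Lemma cstE (V' : lmodType k) (v : V'[ħ]) : v = cst v.1 + hbar *: cst v.2.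
Proof.
by apply: dualmodP; rewrite !dualmodE /= ?scale0r ?scaler0 ?scale1r ?(addr0, add0r).
Qed.

Fact cst_tens_bilinear : bilinearf (fun (v : V) (w : W) =>
  (cst v ⊗ cst w : restr (V[ħ] ⨂ W[ħ]))).
Proof.
have cstP (V' : lmodType k) a (x y : V') :
    cst (a *: x + y) = ((a, 0) : dual k) *: cst x + cst y.
  by apply: dualmodP; rewrite !dualmodE //= scale0r scaler0 !addr0.
split=> [w|v] a x y.
  by rewrite cstP tensDl tensZl.
by rewrite cstP tensDr tensZr.
Qed.
Definition cst_tens : {linear V ⨂ W -> restr (V[ħ] ⨂ W[ħ])} :=
  tlift cst_tens_bilinear.
Lemma cst_tensE v w : cst_tens (v ⊗ w) = cst v ⊗ cst w.
Proof. exact: tliftE. Qed.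

Definition tens_of_dual_fun (t : (V ⨂ W)[ħ]) : M :=
  cst_tens t.1 + hbar *: (cst_tens t.2 : M).
Fact tens_of_dual_linear : linear tens_of_dual_fun.
Proof.
move=> a t s; rewrite /tens_of_dual_fun !dualmodE.
have cZ b x : (cst_tens (b *: x) : M) = ((b, 0) : dual k) *: (cst_tens x : M).
  by rewrite linearZ.
have cD x y : (cst_tens (x + y) : M) = (cst_tens x : M) + (cst_tens y : M).
  by rewrite linearD.
rewrite !cD !cZ [in RHS](dual_hbar a) !scalerDr !scalerDl !scalerA.
rewrite -[_ * hbar * hbar]mulrA hbar2 mulr0 scale0r addr0 ![hbar * _]mulrC.
by rewrite (AC (2*3) ((1*4)*3*(2*5))).
Qed.
Definition tens_of_dual : {linear (V ⨂ W)[ħ] -> M} :=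
  mk_linear tens_of_dual_linear.
Lemma tens_of_dualE t :
  tens_of_dual t = cst_tens t.1 + hbar *: (cst_tens t.2 : M).
Proof. by []. Qed.

Lemma dual_of_tensE v w : dual_of_tens (v ⊗ w) = tens_dual v w.
Proof. exact: tliftE. Qed.

(** The two constructions are inverse to each other: the tensor product over the
    dual numbers of V[ħ] and W[ħ] is (V ⨂ W)[ħ]. *)
Lemma dual_of_tensK : cancel dual_of_tens tens_of_dual.
Proof.
move=> t.
suff E : tens_of_dual ∘ dual_of_tens = lid by exact: (eq_lmap E).
apply: tlift_unique => v w; rewrite lcompE lidE dual_of_tensE tens_of_dualE.
rewrite tens_dual1 tens_dual2 linearD !cst_tensE [in RHS](cstE v) [in RHS](cstE w).
rewrite !(tensDl, tensDr, tensZl, tensZr) scalerA hbar2 scale0r addr0.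
by rewrite scalerDr addrA addrAC.
Qed.

Lemma tens_of_dualK : cancel tens_of_dual dual_of_tens.
Proof.
have cK t : dual_of_tens (cst_tens t) = cst t.
  have -> : (cst_tens t : M) = \sum_(p <- tensor_repr t) cst p.1 ⊗ cst p.2.
    rewrite [in LHS](tensor_sumE t) linear_sum.
    by apply: eq_bigr => p _; apply: cst_tensE.
  rewrite linear_sum; under eq_bigr do rewrite dual_of_tensE.
  rewrite [in RHS](tensor_sumE t); elim: (tensor_repr t) => [|p r IH].
    by rewrite !big_nil.
  rewrite !big_cons IH; apply: dualmodP; rewrite !dualmodE ?tens_dual1 //.
  by rewrite tens_dual2 tens0l tens0r !addr0.
by move=> t; rewrite tens_of_dualE linearD linearZ /= !cK -cstE.
Qed.
End TensorDual.

Section Frames.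
Variable k : comNzRingType.

(** Iterated tensor products of modules V[ħ] are not of this form themselves but
    only isomorphic to some W[ħ]; a frame records the isomorphism. *)
Record frame (V : lmodType k) (M : lmodType (dual k)) := Frame {
  dcoord : {linear M -> V[ħ]};
  dpoint : {linear V[ħ] -> M};
  dcoordK : cancel dcoord dpoint;
  dpointK : cancel dpoint dcoord
}.

Variables (V W : lmodType k) (M N : lmodType (dual k)).
Variables (fM : frame V M) (fN : frame W N).

Definition coord_tens : {linear M ⨂ N -> (V ⨂ W)[ħ]} :=
  dual_of_tens V W ∘ (dcoord fM ⊠ dcoord fN).
Definition point_tens : {linear (V ⨂ W)[ħ] -> M ⨂ N} :=
  (dpoint fM ⊠ dpoint fN) ∘ tens_of_dual V W.

Lemma coord_tensE m n :
  coord_tens (m ⊗ n) = tens_dual (dcoord fM m) (dcoord fN n).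
Proof. by rewrite /coord_tens lcompE tmapE dual_of_tensE. Qed.

Fact coord_tensK : cancel coord_tens point_tens.
Proof.
move=> t; rewrite /coord_tens /point_tens !lcompE dual_of_tensK.
by apply: tmap_cancel; apply: dcoordK.
Qed.
Fact point_tensK : cancel point_tens coord_tens.
Proof.
move=> t; rewrite /coord_tens /point_tens !lcompE.
rewrite [X in dual_of_tens _ _ X]tmap_cancel; try exact: dpointK.
exact: tens_of_dualK.
Qed.
Definition frame_tens : frame (V ⨂ W) (M ⨂ N) := Frame coord_tensK point_tensK.

Lemma coord_frameE m n :
  dcoord frame_tens (m ⊗ n) = tens_dual (dcoord fM m) (dcoord fN n).
Proof. exact: coord_tensE. Qed.

(** In the coordinates given by the frames, F is f0 + ħ f1. *)
Definition lifts (F : {linear M -> N}) (f0 f1 : {linear V -> W}) : Prop :=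
  forall m, dcoord fN (F m) = ext f0 f1 (dcoord fM m).

Lemma liftsP F f0 f1 :
  dcoord fN ∘ F = ext f0 f1 ∘ dcoord fM -> lifts F f0 f1.
Proof. by move=> E m; apply: (eq_lmap E). Qed.

Definition lift_of (f0 f1 : {linear V -> W}) : {linear M -> N} :=
  dpoint fN ∘ ext f0 f1 ∘ dcoord fM.

Lemma lift_ofP f0 f1 : lifts (lift_of f0 f1) f0 f1.
Proof. by move=> m; rewrite /lift_of !lcompE dpointK. Qed.

(** An identity over the dual numbers can be proved degree by degree; conversely,
    by lifts_inj, it can be split into its two coefficients. *)
Lemma lifts_unique F G f0 f1 : lifts F f0 f1 -> lifts G f0 f1 -> F = G.
Proof.
move=> lF lG; apply: lmapP => m; apply: (can_inj (dcoordK fN)).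
by rewrite lF lG.
Qed.

Lemma lifts_inj F f0 f1 g0 g1 : lifts F f0 f1 -> lifts F g0 g1 ->
  f0 = g0 /\ f1 = g1.
Proof.
by move=> lF lG; apply: ext_inj => v; rewrite -(dpointK fM v) -lF -lG.
Qed.

Lemma lifts_eq F f0 f1 g0 g1 :
  lifts F f0 f1 -> f0 = g0 -> f1 = g1 -> lifts F g0 g1.
Proof. by move=> lF <- <-. Qed.
End Frames.

Lemma lid_cancel (k : comNzRingType) (V : lmodType k) :
  cancel (@lid (dual k) V[ħ]) lid.
Proof. by []. Qed.
Definition frame_id (k : comNzRingType) (V : lmodType k) : frame V V[ħ] :=
  Frame (@lid_cancel k V) (@lid_cancel k V).

Lemma lifts_tens (k : comNzRingType) (U V W : lmodType k)
  (L M N : lmodType (dual k)) (fL : frame U L) (fM : frame V M) (fN : frame W N)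
  (F : {linear L ⨂ M -> N}) f0 f1 :
  (forall u v,
    dcoord fN (F (u ⊗ v)) = ext f0 f1 (tens_dual (dcoord fL u) (dcoord fM v))) ->
  lifts (frame_tens fL fM) fN F f0 f1.
Proof.
move=> FE; apply: liftsP; apply: tlift_unique => u v.
by rewrite [LHS]lcompE [RHS]lcompE FE coord_frameE.
Qed.

Section LiftsTheory.
Variable k : comNzRingType.
Variables (U V W X : lmodType k) (L M N P : lmodType (dual k)).
Variables (fL : frame U L) (fM : frame V M) (fN : frame W N) (fP : frame X P).

Lemma lifts_id : lifts fM fM lid lid 0.
Proof. by move=> m; apply: dualmodP; rewrite // ext2 !lidE addr0. Qed.

(** As ħ^2 = 0, the part of degree one obeys the Leibniz rule, here and in
    lifts_tmap. *)
Lemma lifts_comp (G : {linear M -> N}) (F : {linear L -> M}) g0 g1 f0 f1 :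
  lifts fM fN G g0 g1 -> lifts fL fM F f0 f1 ->
  lifts fL fN (G ∘ F) (g0 ∘ f0) (g0 ∘ f1 + g1 ∘ f0).
Proof. by move=> lG lF m; rewrite lcompE lG lF ext_comp. Qed.

Lemma lifts_tmap (F : {linear L -> N}) (G : {linear M -> P}) f0 f1 g0 g1 :
  lifts fL fN F f0 f1 -> lifts fM fP G g0 g1 ->
  lifts (frame_tens fL fM) (frame_tens fN fP)
    (F ⊠ G) (f0 ⊠ g0) (f0 ⊠ g1 + f1 ⊠ g0).
Proof.
move=> lF lG; apply: lifts_tens => u v; rewrite tmapE coord_frameE lF lG.
apply: dualmodP; rewrite ?tens_dual1 ?tens_dual2 !(ext1, ext2).
  by rewrite tens_dual1 tmapE.
rewrite tens_dual1 tens_dual2 linearD lmapDE !tmapE !(tensDl, tensDr).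
by rewrite addrACA.
Qed.

Lemma lifts_tassoc :
  lifts (frame_tens (frame_tens fL fM) fN) (frame_tens fL (frame_tens fM fN))
    tassoc tassoc 0.
Proof.
apply: liftsP; apply: tlift_unique3l => l m n.
rewrite [LHS]lcompE [RHS]lcompE tassocE !coord_frameE.
apply: dualmodP; rewrite !(ext1, ext2) !(tens_dual1, tens_dual2).
  by rewrite tassocE.
by rewrite lmap0E addr0 !(tensDl, tensDr) !linearD !tassocE addrA.
Qed.

Lemma lifts_tassocV :
  lifts (frame_tens fL (frame_tens fM fN)) (frame_tens (frame_tens fL fM) fN)
    tassocV tassocV 0.
Proof.
apply: liftsP; apply: tlift_unique3 => l m n.
rewrite [LHS]lcompE [RHS]lcompE tassocVE !coord_frameE.
apply: dualmodP; rewrite !(ext1, ext2) !(tens_dual1, tens_dual2).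
  by rewrite tassocVE.
by rewrite lmap0E addr0 !(tensDl, tensDr) !linearD !tassocVE addrA.
Qed.

Lemma lifts_swapl :
  lifts (frame_tens fL (frame_tens fM fN)) (frame_tens fM (frame_tens fL fN))
    swapl swapl 0.
Proof.
apply: liftsP; apply: tlift_unique3 => l m n.
rewrite [LHS]lcompE [RHS]lcompE swaplE !coord_frameE.
apply: dualmodP; rewrite !(ext1, ext2) !(tens_dual1, tens_dual2).
  by rewrite swaplE.
rewrite lmap0E addr0 !(tensDl, tensDr) !linearD !swaplE.
by rewrite addrAC.
Qed.
End LiftsTheory.

Section LiftsOperators.
Variables (k : comNzRingType) (V : lmodType k) (M : lmodType (dual k)).
Variable fM : frame V M.
Local Notation a1 := fM.
Local Notation a2 := (frame_tens a1 a1).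
Local Notation a3 := (frame_tens a1 a2).

Lemma lifts_op12 F f0 f1 : lifts a2 a2 F f0 f1 ->
  lifts a3 a3 (op12 F) (op12 f0) (op12 f1).
Proof.
move=> lF; have l := lifts_comp (lifts_comp (lifts_tassoc a1 a1 a1)
  (lifts_tmap lF (lifts_id a1))) (lifts_tassocV a1 a1 a1).
by apply: (lifts_eq l); rewrite ?lmap_simp.
Qed.

Lemma lifts_op23 F f0 f1 : lifts a2 a2 F f0 f1 ->
  lifts a3 a3 (op23 F) (op23 f0) (op23 f1).
Proof.
move=> lF; apply: (lifts_eq (lifts_tmap (lifts_id a1) lF)) => //.
by rewrite ?lmap_simp.
Qed.

Lemma lifts_con12 F f0 f1 : lifts a2 a1 F f0 f1 ->
  lifts a3 a2 (con12 F) (con12 f0) (con12 f1).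
Proof.
move=> lF; have l := lifts_comp (lifts_tmap lF (lifts_id a1))
  (lifts_tassocV a1 a1 a1).
by apply: (lifts_eq l); rewrite ?lmap_simp.
Qed.

Lemma lifts_con23 F f0 f1 : lifts a2 a1 F f0 f1 ->
  lifts a3 a2 (con23 F) (con23 f0) (con23 f1).
Proof.
move=> lF; apply: (lifts_eq (lifts_tmap (lifts_id a1) lF)) => //.
by rewrite ?lmap_simp.
Qed.

Lemma lifts_sandwich m m0 m1 : lifts a3 a1 m m0 m1 ->
  lifts (frame_tens a1 a3) a2 (sandwich m) (sandwich m0) (sandwich m1).
Proof.
move=> lm.
have l := lifts_comp (lifts_tmap (lifts_id a1) lm) (lifts_comp
  (lifts_tmap (lifts_id a1) (lifts_swapl a1 a1 a1)) (lifts_swapl a1 a1 a2)).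
by apply: (lifts_eq l); rewrite ?lmap_simp.
Qed.
End LiftsOperators.

(** * Consequences of the normalization *)

Section CocycleNormalization.
Variables (k : comNzRingType) (H : hopfAlgType k).
Variable c : {linear H ⨂ H -> H} * {linear H -> H ⨂ H}.
Hypothesis hc : hopf_cocycle c.
Implicit Types (x y z : H).
Local Notation Δ := (@comul k H).
Local Notation ε := (@counit k H).

Fact counitl_map_bilinear : bilinearf (fun a b : H => ε a *: b).
Proof. lin. Qed.
Definition counitl_map : {linear H ⨂ H -> H} := tlift counitl_map_bilinear.
Lemma counitl_mapE a b : counitl_map (a ⊗ b) = ε a *: b.
Proof. exact: tliftE. Qed.
Fact counitr_map_bilinear : bilinearf (fun a b : H => ε b *: a).
Proof. lin. Qed.
Definition counitr_map : {linear H ⨂ H -> H} := tlift counitr_map_bilinear.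
Lemma counitr_mapE a b : counitr_map (a ⊗ b) = ε b *: a.
Proof. exact: tliftE. Qed.

Lemma counitl_mapM s t :
  counitl_map (tmul s t) = counitl_map s * counitl_map t.
Proof.
rewrite /tmul (linear_tsum counitl_map) [in RHS](linear_tensE counitl_map s).
rewrite tsum_mull; apply: eq_tsum => a b.
rewrite (linear_tsum counitl_map) [in RHS](linear_tensE counitl_map t).
rewrite tsum_mulr; apply: eq_tsum => d e.
by rewrite !counitl_mapE counitM -scalerAl -scalerAr scalerA.
Qed.

Lemma counitl_mapK x : counitl_map (Δ x) = x.
Proof. exact: comul_counitl. Qed.

(** The compatibility of ξ and ζ at x = y = 1 reads ζ(1) = ζ(1) + ζ(1); hence the
    deformed coproduct preserves the unit. *)
Lemma cocycle_comul1 : c.2 1 = 0.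
Proof.
have := hopf_cocycle_compat hc 1 1.
rewrite mulr1 comul1 !tsum_tens; try by lin.
rewrite !(hopf_cocycle_mul1l hc) tens0l tens0r linear0 !add0r tmulr1 tmul1r.
by move/(congr1 (fun t => t - c.2 1)); rewrite addrK subrr.
Qed.

(** Apply ε ⊗ 1 to the compatibility of ξ and ζ, which is where the normalization
    of ζ enters, and then ε: all that remains is ε(ξ(x ⊗ y)) = 0.  Hence ε stays
    multiplicative for the deformed product. *)
Lemma counit_cocycle x y : ε (c.1 (x ⊗ y)) = 0.
Proof.
have := congr1 counitl_map (hopf_cocycle_compat hc x y).
have Z u : counitl_map (c.2 u) = 0 by apply: hopf_cocycle_counitl hc u.
rewrite !(linearD counitl_map) !counitl_mapM !counitl_mapK !Z mul0r mulr0 !addr0.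
rewrite !(linear_tsum counitl_map).
have -> : \sw_(x1, x2 <- Δ x) counitl_map
    (\sw_(y1, y2 <- Δ y) (x1 * y1) ⊗ c.1 (x2 ⊗ y2)) = c.1 (x ⊗ y).
  rewrite -[RHS](@sweedler_counitl k H H x (fun x => c.1 (x ⊗ y))); last by lin.
  apply: eq_tsum => x1 x2; rewrite (linear_tsum counitl_map).
  rewrite -[in RHS](@sweedler_counitl k H H y (fun y => c.1 (x2 ⊗ y))); last by lin.
  rewrite linear_fun_tsum; last by lin.
  by apply: eq_tsum => y1 y2; rewrite counitl_mapE counitM scalerA.
(* Subtract ξ(x ⊗ y): the sum of the ε(ξ(x1 ⊗ y1)) x2 y2 is 0. Apply ε. *)
move/(congr1 (fun u => ε (u - c.1 (x ⊗ y)))); rewrite subrr addrC addKr.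
(* Sums with values in k are taken in the regular module. *)
have lε : linear (ε : H -> k^o) by move=> a u v; rewrite linearP.
have lin_ε (F : H -> H) : linear F -> linear (fun u => ε (F u) : k^o).
  by move=> lF a u v; rewrite lF lε.
rewrite linear0 (linear_fun_tsum _ _ lε) => /esym; apply: etrans; symmetry.
rewrite -[RHS](@sweedler_counitr k H k^o x (fun x => ε (c.1 (x ⊗ y))));
  last by apply: lin_ε; lin.
apply: eq_bigr => -[x1 x2] _ /=.
rewrite (linear_tsum counitl_map) (linear_fun_tsum _ _ lε).
rewrite -[in RHS](@sweedler_counitr k H k^o y (fun y => ε (c.1 (x1 ⊗ y))));
  last by apply: lin_ε; lin.
rewrite /tsum scaler_sumr; apply: eq_bigr => -[y1 y2] _ /=.
rewrite counitl_mapE linearZ /= counitM.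
by rewrite [LHS]mulrC -mulrA.
Qed.
End CocycleNormalization.

(** * The deformed Hopf algebra *)

(** The cocycle is a parameter of the type, so that each cocycle has its own
    Hopf algebra structure on H[ħ]. *)
Definition deform (k : comNzRingType) (H : hopfAlgType k) c
  & @hopf_cocycle k H c := H[ħ].

Section Deformation.
Variables (k : comNzRingType) (H : hopfAlgType k).
Variable c : {linear H ⨂ H -> H} * {linear H -> H ⨂ H}.
Hypothesis hc : hopf_cocycle c.
Local Notation Δ := (@comul k H).
Local Notation ε := (@counit k H).
Local Notation S := (@antipode k H).
Local Notation S' := (mk_linear (antipode'_linear c)).
Local Notation A := (deform hc).

HB.instance Definition _ := GRing.Lmodule.copy A H[ħ].
Implicit Types x y z : A.

Definition deform_one : A := (1, 0).
Definition deform_mul x y : A :=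
  (x.1 * y.1, x.1 * y.2 + x.2 * y.1 + c.1 (x.1 ⊗ y.1)).

Fact deform_mulA : associative deform_mul.
Proof.
move=> [x0 x1] [y0 y1] [z0 z1]; apply: dualmodP; rewrite /= ?mulrA //.
rewrite !mulrDr !mulrDl !mulrA -!addrA; do 2!congr (_ + _).
by rewrite (hopf_cocycle_mul hc) addrCA.
Qed.
Fact deform_mul1l : left_id deform_one deform_mul.
Proof.
move=> [x0 x1]; apply: dualmodP; rewrite /= !mul1r //.
by rewrite (hopf_cocycle_mul1l hc) mul0r !addr0.
Qed.
Fact deform_mul1r : right_id deform_one deform_mul.
Proof.
move=> [x0 x1]; apply: dualmodP; rewrite /= !mulr1 //.
by rewrite (hopf_cocycle_mul1r hc) mulr0 addr0 add0r.
Qed.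
Fact deform_mulDl : left_distributive deform_mul +%R.
Proof.
move=> [x0 x1] [y0 y1] [z0 z1]; apply: dualmodP; rewrite /= !mulrDl //.
by rewrite tensDl linearD /= (AC (2*2*2) ((1*3*5)*(2*4*6))).
Qed.
Fact deform_mulDr : right_distributive deform_mul +%R.
Proof.
move=> [x0 x1] [y0 y1] [z0 z1]; apply: dualmodP; rewrite /= !mulrDr //.
by rewrite tensDr linearD /= (AC (2*2*2) ((1*3*5)*(2*4*6))).
Qed.
Fact deform_one_neq0 : deform_one != 0.
Proof. by apply/eqP => -[] /eqP; rewrite oner_eq0. Qed.
HB.instance Definition _ := GRing.Zmodule_isNzRing.Build A
  deform_mulA deform_mul1l deform_mul1r deform_mulDl deform_mulDr
  deform_one_neq0.

Lemma deformM1 x y : (x * y).1 = x.1 * y.1. Proof. by []. Qed.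
Lemma deformM2 x y : (x * y).2 = x.1 * y.2 + x.2 * y.1 + c.1 (x.1 ⊗ y.1).
Proof. by []. Qed.

Fact deform_scalerAl (a : dual k) x y : a *: (x * y) = (a *: x) * y.
Proof.
apply: dualmodP; rewrite !(dualmodE, deformM1, deformM2) ?scalerAl //.
rewrite tensZl linearZ /= !scalerDr !scalerAl mulrDl.
by rewrite (AC (3*1) (1*(2*4)*3)).
Qed.
Fact deform_scalerAr (a : dual k) x y : a *: (x * y) = x * (a *: y).
Proof.
apply: dualmodP; rewrite !(dualmodE, deformM1, deformM2) ?scalerAr //.
rewrite tensZr linearZ /= !scalerDr !scalerAr mulrDr.
by rewrite (AC (3*1) ((1*4)*2*3)).
Qed.
HB.instance Definition _ := GRing.Lmodule_isLalgebra.Build (dual k) A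
  deform_scalerAl.
HB.instance Definition _ := GRing.Lalgebra_isAlgebra.Build (dual k) A
  deform_scalerAr.

Definition deform_frame : frame H A := frame_id H.
Local Notation a1 := deform_frame.
Local Notation a2 := (frame_tens a1 a1).
Local Notation a3 := (frame_tens a1 a2).

Lemma coord_deform x : dcoord a1 x = x. Proof. by []. Qed.

Definition deform_comul : {linear A -> A ⨂ A} := lift_of a1 a2 Δ c.2.
Lemma lifts_comul : lifts a1 a2 deform_comul Δ c.2.
Proof. exact: lift_ofP. Qed.

Definition deform_antipode : {linear A -> A} :=
  lift_of a1 a1 S S'.
Lemma lifts_antipode : lifts a1 a1 deform_antipode S S'.
Proof. exact: lift_ofP. Qed.

Definition deform_counit_fun x : (dual k)^o := (ε x.1, ε x.2).
Fact deform_counit_linear : linear deform_counit_fun.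
Proof.
move=> a x y; apply: dualP; rewrite /= ?linearP //.
by rewrite linearD linearP /=; rewrite linearZ.
Qed.
Definition deform_counit : {scalar A} :=
  mk_linear deform_counit_linear.

Lemma lifts_mulm : lifts a2 a1 mulm mulm c.1.
Proof.
apply: lifts_tens => x y; rewrite mulmE; apply: dualmodP.
  by rewrite ext1 tens_dual1 mulmE.
by rewrite ext2 tens_dual1 tens_dual2 (linearD mulm) !mulmE.
Qed.

(** The part of degree one is the cocycle condition on ζ. *)
Lemma deform_comulA x :
  (lid ⊠ deform_comul) (deform_comul x) =
  tassoc ((deform_comul ⊠ lid) (deform_comul x)).
Proof.
suff E : (lid ⊠ deform_comul) ∘ deform_comul =
    tassoc ∘ ((deform_comul ⊠ lid) ∘ deform_comul).
  exact: (eq_lmap E).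
have ll := @lifts_comp _ _ _ _ _ _ _ a1 a2 a3 _ _ _ _ _ _
  (lifts_tmap (lifts_id a1) lifts_comul) lifts_comul.
have lr := lifts_comp (lifts_tassoc a1 a1 a1)
  (lifts_comp (lifts_tmap lifts_comul (lifts_id a1)) lifts_comul).
apply: (lifts_unique ll (lifts_eq lr _ _)); rewrite ?lmap_simp;
  apply: lmapP => y.
  exact: esym (comulA y).
have := hopf_cocycle_comul hc y; rewrite addrC -linearD /= [X in tassoc X]addrC.
by move->.
Qed.

Fact counitl_bilinear : bilinearf (fun a b : A => deform_counit a *: b).
Proof. by split=> [b|a]; [apply: lin_scalar|apply: lin_scale]. Qed.
Fact counitr_bilinear : bilinearf (fun a b : A => deform_counit b *: a).
Proof. by split=> [b|a]; [apply: lin_scale|apply: lin_scalar]. Qed.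

Lemma deform_comul_counitl x :
  \sw_(a, b <- deform_comul x) deform_counit a *: b = x.
Proof.
have lF : lifts a2 a1 (tlift counitl_bilinear) (counitl_map H) 0.
  apply: lifts_tens => u v; rewrite tliftE.
  apply: dualmodP; rewrite !(ext1, ext2) ?tens_dual1 ?tens_dual2.
    by rewrite counitl_mapE.
  by rewrite (linearD (counitl_map H)) !counitl_mapE lmap0E addr0.
rewrite -[RHS](lidE x).
suff E : tlift counitl_bilinear ∘ deform_comul = lid.
  exact: (eq_lmap E).
apply: (lifts_unique (lifts_eq (lifts_comp lF lifts_comul) _ _) (lifts_id a1)).
  by apply: lmapP => y; apply: counitl_mapK.
by rewrite !lmap_simp; apply: lmapP => y; apply: hopf_cocycle_counitl hc y.
Qed.

Lemma deform_comul_counitr x :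
  \sw_(a, b <- deform_comul x) deform_counit b *: a = x.
Proof.
have lF : lifts a2 a1 (tlift counitr_bilinear) (counitr_map H) 0.
  apply: lifts_tens => u v; rewrite tliftE.
  apply: dualmodP; rewrite !(ext1, ext2) ?tens_dual1 ?tens_dual2.
    by rewrite counitr_mapE.
  by rewrite (linearD (counitr_map H)) !counitr_mapE lmap0E addr0 [RHS]addrC.
rewrite -[RHS](lidE x).
suff E : tlift counitr_bilinear ∘ deform_comul = lid.
  exact: (eq_lmap E).
apply: (lifts_unique (lifts_eq (lifts_comp lF lifts_comul) _ _) (lifts_id a1)).
  by apply: lmapP => y; apply: comul_counitr.
by rewrite !lmap_simp; apply: lmapP => y; apply: hopf_cocycle_counitr hc y.
Qed.

Definition tmul_map : {linear (H ⨂ H) ⨂ (H ⨂ H) -> H ⨂ H} :=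
  tlift (@tmul_bilinear k H).
Lemma tmul_mapE s t : tmul_map (s ⊗ t) = tmul s t.
Proof. exact: tliftE. Qed.
Fact tmul'_bilinear : bilinearf (fun s t : H ⨂ H =>
  \sw_(x1, x2 <- s) \sw_(y1, y2 <- t) (x1 * y1) ⊗ c.1 (x2 ⊗ y2)
  + \sw_(x1, x2 <- s) \sw_(y1, y2 <- t) c.1 (x1 ⊗ y1) ⊗ (x2 * y2)).
Proof. lin. Qed.
Definition tmul'_map : {linear (H ⨂ H) ⨂ (H ⨂ H) -> H ⨂ H} :=
  tlift tmul'_bilinear.
Lemma tmul'_mapE (x1 x2 y1 y2 : H) : tmul'_map ((x1 ⊗ x2) ⊗ (y1 ⊗ y2)) =
  (x1 * y1) ⊗ c.1 (x2 ⊗ y2) + c.1 (x1 ⊗ y1) ⊗ (x2 * y2).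
Proof. rewrite tliftE !tsum_tens //; lin. Qed.

Lemma lifts_tmul : lifts (frame_tens a2 a2) a2 (tlift (@tmul_bilinear _ A))
  tmul_map tmul'_map.
Proof.
apply: liftsP; apply: tlift_unique4 => x1 x2 y1 y2; rewrite [LHS]lcompE [RHS]lcompE.
rewrite tliftE tmul_tens !coord_frameE; apply: dualmodP.
  by rewrite ext1 !tens_dual1 tmul_mapE tmul_tens.
rewrite ext2 !(tens_dual1, tens_dual2) tmul'_mapE.
rewrite !deformM2 !deformM1 !(tensDr, tensDl).
rewrite !(linearD tmul_map) !tmul_mapE !tmul_tens.
by rewrite !coord_deform (AC (3*3) (1*4*(2*5)*(3*6))).
Qed.

(** The part of degree one is the compatibility of ξ and ζ. *)
Lemma deform_comulM x y :
  deform_comul (x * y) = tmul (deform_comul x) (deform_comul y).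
Proof.
suff E : deform_comul ∘ mulm =
    tlift (@tmul_bilinear _ A) ∘ (deform_comul ⊠ deform_comul).
  transitivity ((deform_comul ∘ mulm) (x ⊗ y)); first by rewrite lcompE mulmE.
  by rewrite E lcompE tmapE tliftE.
apply: (lifts_unique (lifts_comp lifts_comul lifts_mulm)).
apply: (lifts_eq (lifts_comp lifts_tmul (lifts_tmap lifts_comul lifts_comul)));
  apply: tlift_unique => u v.
  by rewrite [LHS]lcompE [RHS]lcompE tmapE tmul_mapE mulmE comulM.
change (tmul_map ((Δ ⊠ c.2 + c.2 ⊠ Δ) (u ⊗ v)) + tmul'_map ((Δ ⊠ Δ) (u ⊗ v))
  = Δ (c.1 (u ⊗ v)) + c.2 (mulm (u ⊗ v))).
rewrite lmapDE !tmapE (linearD tmul_map) !tmul_mapE mulmE tliftE.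
by rewrite (hopf_cocycle_compat hc) addrC [X in _ + X]addrC addrA.
Qed.

Lemma deform_comul1 : deform_comul 1 = 1 ⊗ 1.
Proof.
apply: (can_inj (dcoordK a2)); rewrite lifts_comul coord_frameE.
apply: dualmodP; rewrite ?ext1 ?ext2 ?tens_dual1 ?tens_dual2 /= ?comul1 //.
by rewrite linear0 (cocycle_comul1 hc) tens0l tens0r.
Qed.

Lemma deform_counit1 : deform_counit 1 = 1.
Proof. by apply: dualP; rewrite /= ?counit1 ?linear0. Qed.
Lemma deform_counitM x y :
  deform_counit (x * y) = deform_counit x * deform_counit y.
Proof.
apply: dualP; rewrite ?dualE.
  by rewrite /= counitM.
by rewrite /= !(linearD ε) !counitM (counit_cocycle hc) addr0.
Qed.

Definition unit_counit : {linear H -> H} :=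
  mk_linear (@lin_scalar k H H H ε id 1 (@lin_id _ _)).
Definition deform_unit_counit : {linear A -> A} :=
  mk_linear (@lin_scalar _ A A A deform_counit id 1 (@lin_id _ _)).
Lemma lifts_unit_counit : lifts a1 a1 deform_unit_counit unit_counit 0.
Proof.
move=> x; apply: dualmodP; rewrite ?ext1 ?ext2 //.
by rewrite lmap0E addr0 [LHS](_ : _ = ε x.1 *: 0 + ε x.2 *: 1) // scaler0 add0r.
Qed.

(** The degree-one part of x1 S(x2) for the deformed product and coproduct and
    the undeformed S.  It is what S' has to compensate for. *)
Definition antipode_defect (x : H) : H :=
  \sw_(a, b <- Δ x) c.1 (a ⊗ S b) + mulm ((lid ⊠ S) (c.2 x)).

Lemma antipode'E (x : H) :
  antipode' c x = - \sw_(a, b <- Δ x) (S a * antipode_defect b).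
Proof.
rewrite /antipode' -opprD; congr (- _).
rewrite /comul3 tsum_tmap; last by lin.
rewrite -tsumD; apply: eq_tsum => a b.
by rewrite -tsum_mulr -mulrDr.
Qed.

Lemma deform_antipoder x :
  \sw_(a, b <- deform_comul x) a * deform_antipode b = deform_counit x *: 1.
Proof.
rewrite -(mulm_tmap lid deform_antipode).
suff E : mulm ∘ ((lid ⊠ deform_antipode) ∘ deform_comul) = deform_unit_counit.
  exact: (eq_lmap E).
have l := lifts_comp lifts_mulm
  (lifts_comp (lifts_tmap (lifts_id a1) lifts_antipode) lifts_comul).
apply: (lifts_unique (lifts_eq l _ _) lifts_unit_counit); rewrite ?lmap_simp;
  apply: lmapP => y.
  by rewrite [LHS]lcompE (mulm_tmap lid S) antipoder.
change (mulm ((lid ⊠ S) (c.2 y) + (lid ⊠ S') (Δ y)) + c.1 ((lid ⊠ S) (Δ y)) = 0).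
rewrite (linearD mulm) (mulm_tmap lid S').
have -> : \sw_(a, b <- Δ y) (lid a * S' b) = - antipode_defect y.
  rewrite -[in RHS](@mul_antipodeK k H antipode_defect y); last first.
    by rewrite /antipode_defect; lin.
  rewrite -sumrN; apply: eq_bigr => p _; rewrite -mulrN.
  by congr (_ * _); apply: antipode'E.
rewrite /antipode_defect opprD addrCA subrr addr0.
by rewrite tmap_tsumE (linear_tsum c.1) addNr.
Qed.

Definition antipode_conv_id : {linear A -> A} :=
  mulm ∘ ((deform_antipode ⊠ lid) ∘ deform_comul).
Lemma antipode_conv_idE x :
  antipode_conv_id x = \sw_(a, b <- deform_comul x) (deform_antipode a * b).
Proof. exact: mulm_tmap. Qed.

(** In the convolution algebra e = S * id satisfies e * e = S * (id * S) * id = e,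
    since S is already known to be a right inverse of id. *)
Lemma antipode_conv_id_idem :
  mulm ∘ ((antipode_conv_id ⊠ antipode_conv_id) ∘ deform_comul) = antipode_conv_id.
Proof.
apply: lmapP => x; rewrite [LHS]lcompE mulm_tmap antipode_conv_idE.
(* This is id * (S * id) = (id * S) * id = id. *)
have inner y : \sw_(a, b <- deform_comul y) (a * antipode_conv_id b) = y.
  transitivity (\sw_(a, b <- deform_comul y) \sw_(d, e <- deform_comul b)
      (a * (deform_antipode d * e))).
    by apply: eq_tsum => a b; rewrite antipode_conv_idE tsum_mulr.
  rewrite (coassoc_tsum (F := fun a d e => a * (deform_antipode d * e))
    (deform_comulA y));
    last by trilin.
  rewrite -[RHS]deform_comul_counitl; apply: eq_tsum => a b.
  under eq_tsum do rewrite mulrA.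
  by rewrite -tsum_mull deform_antipoder -scalerAl mul1r.
transitivity (\sw_(a, b <- deform_comul x) \sw_(d, e <- deform_comul a)
   (deform_antipode d * e * antipode_conv_id b)).
  by apply: eq_tsum => a b; rewrite [antipode_conv_id a]antipode_conv_idE tsum_mull.
rewrite -(coassoc_tsum
    (F := fun a d e => deform_antipode a * d * antipode_conv_id e)
    (deform_comulA x)); last by trilin.
apply: eq_tsum => a b; rewrite -[in RHS](inner b) tsum_mulr.
by apply: eq_tsum => d e; rewrite mulrA.
Qed.

(** By the previous lemma e = S * id is idempotent, and e = ηε + ħu for some u
    because S is an antipode in degree zero.  The part of degree one of
    e * e = e is u + u = u. *)
Lemma deform_antipodel x :
  \sw_(a, b <- deform_comul x) deform_antipode a * b = deform_counit x *: 1.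
Proof.
rewrite -antipode_conv_idE.
suff E : antipode_conv_id = deform_unit_counit.
  exact: (eq_lmap E).
have l := lifts_comp lifts_mulm
  (lifts_comp (lifts_tmap lifts_antipode (lifts_id a1)) lifts_comul).
(* Only the constant part of e is computed; u is whatever the lift provides. *)
have {l} [u l] : exists u, lifts a1 a1 antipode_conv_id unit_counit u.
  eexists; apply: (lifts_eq l) => //; apply: lmapP => y.
  by rewrite [LHS]lcompE (mulm_tmap S lid) antipodel.
have l2 := lifts_comp lifts_mulm (lifts_comp (lifts_tmap l l) lifts_comul).
rewrite antipode_conv_id_idem in l2.
have [_ uE] := lifts_inj l2 l.
apply: (lifts_unique (lifts_eq l _ _) lifts_unit_counit) => //.
apply: lmapP => y; rewrite lmap0E.
have := congr1 (fun f : {linear H -> H} => f y) uE.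
change (mulm ((unit_counit ⊠ unit_counit) (c.2 y)
    + (unit_counit ⊠ u + u ⊠ unit_counit) (Δ y))
  + c.1 ((unit_counit ⊠ unit_counit) (Δ y)) = u y -> u y = 0).
rewrite !lmapDE !(linearD mulm) !mulm_tmap tmap_tsumE (linear_tsum c.1).
have unit_counitE (z : H) : unit_counit z = ε z *: 1 by [].
have -> : \sw_(a, b <- c.2 y) (unit_counit a * unit_counit b) = 0.
  transitivity (unit_counit (counitl_map H (c.2 y))).
    rewrite (linear_tensE (counitl_map H)) (linear_tsum unit_counit).
    apply: eq_tsum => a b.
    by rewrite counitl_mapE linearZ /= !unit_counitE -scalerAl mul1r.
  by rewrite [counitl_map H _](hopf_cocycle_counitl hc y) linear0.
have -> : \sw_(a, b <- Δ y) c.1 (unit_counit a ⊗ unit_counit b) = 0.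
  rewrite /tsum big1 // => p _.
  by rewrite unit_counitE tensZl linearZ /= (hopf_cocycle_mul1l hc) scaler0.
have -> : \sw_(a, b <- Δ y) (unit_counit a * u b) = u y.
  rewrite -[RHS](@sweedler_counitl k H H y u); last exact: linearP.
  by apply: eq_tsum => a b; rewrite unit_counitE -scalerAl mul1r.
have -> : \sw_(a, b <- Δ y) (u a * unit_counit b) = u y.
  rewrite -[RHS](@sweedler_counitr k H H y u); last exact: linearP.
  by apply: eq_tsum => a b; rewrite unit_counitE -scalerAr mulr1.
by rewrite add0r addr0 => /(congr1 (fun z : H => z - u y)); rewrite addrK subrr.
Qed.

HB.instance Definition _ := isHopfAlgebra.Build (dual k) A
  deform_comulA deform_comul_counitl deform_comul_counitr deform_comul1
  deform_comulM deform_counit1 deform_counitM deform_antipodel deform_antipoder.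
End Deformation.

(** * The deformed braiding *)

Lemma hopf_braiding_sandwich (k : comNzRingType) (H : hopfAlgType k) :
  hopf_braiding H = sandwich (mulm ∘ ((@antipode k H) ⊠ mulm)) ∘
    (lid ⊠ ((lid ⊠ (@comul k H)) ∘ (@comul k H))).
Proof.
apply: tlift_unique => x y.
rewrite [RHS]lcompE tmapE sandwichE tliftE.
apply: eq_tsum => a s; apply: eq_tsum => b d.
by rewrite lcompE tmapE !mulmE mulrA.
Qed.

(** The five terms of Ψ are the Leibniz expansion of the previous formula: the
    two from Δ come first, then those from the two products and from S. *)
Lemma Psi_sandwich (k : comNzRingType) (H : hopfAlgType k)
    (c : {linear H ⨂ H -> H} * {linear H -> H ⨂ H})
    (Δ := @comul k H) (S := @antipode k H) :
  Psi c = sandwich (mulm ∘ (S ⊠ mulm)) ∘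
      (lid ⊠ ((lid ⊠ Δ) ∘ c.2 + (lid ⊠ c.2) ∘ Δ)) +
    sandwich (mulm ∘ (S ⊠ c.1 + mk_linear (antipode'_linear c) ⊠ mulm)
             + c.1 ∘ (S ⊠ mulm)) ∘ (lid ⊠ ((lid ⊠ Δ) ∘ Δ)).
Proof.
apply: tlift_unique => x y; rewrite lmapDE [X in X + _]lcompE [X in _ + X]lcompE.
rewrite !tmapE lmapDE tensDr (linearD (sandwich _)) !sandwichE tliftE.
have m0E b d : (mulm ∘ (S ⊠ mulm)) (b ⊗ (x ⊗ d)) = S b * x * d.
  by rewrite lcompE tmapE !mulmE mulrA.
have m1E b d : (mulm ∘ (S ⊠ c.1 + mk_linear (antipode'_linear c) ⊠ mulm)
    + c.1 ∘ (S ⊠ mulm)) (b ⊗ (x ⊗ d)) =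
    S b * c.1 (x ⊗ d) + c.1 (S b ⊗ (x * d)) + antipode' c b * x * d.
  rewrite lmapDE [X in X + _]lcompE lmapDE [X in _ + X]lcompE (linearD mulm).
  by rewrite !tmapE !mulmE mulrA addrAC.
transitivity (\sw_(a, b, d <- (lid ⊠ Δ) (c.2 y)) a ⊗ (S b * x * d)
  + \sw_(a, b, d <- (lid ⊠ c.2) (Δ y)) a ⊗ (S b * x * d)
  + (\sw_(a, b, d <- comul3 y) a ⊗ (S b * c.1 (x ⊗ d))
    + \sw_(a, b, d <- comul3 y) a ⊗ c.1 (S b ⊗ (x * d))
    + \sw_(a, b, d <- comul3 y) a ⊗ (antipode' c b * x * d))).
  rewrite [RHS](AC (2*3) ((3*4)*1*2*5)).
  by case: (c).
congr (_ + _ + _).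
- by apply: eq_tsum => a s; apply: eq_tsum => b d; rewrite m0E.
- by apply: eq_tsum => a s; apply: eq_tsum => b d; rewrite m0E.
rewrite -!tsumD; apply: eq_tsum => a s.
rewrite -!tsumD; apply: eq_tsum => b d.
by rewrite m1E !tensDr.
Qed.

Section DegreeOne.
Variables (k : comNzRingType) (H : hopfAlgType k).
Local Notation C2_Hf := ({linear H ⨂ H -> H} * {linear H -> H ⨂ H})%type.
Implicit Type c : C2_Hf.
Local Notation R := (hopf_braiding H).

(** Each factor of hopf_braiding_sandwich has a lift with known parts, and the
    Leibniz rule yields the formula Psi_sandwich. *)
Lemma lifts_hopf_braiding c (hc : hopf_cocycle c)
  (a2 := frame_tens (deform_frame hc) (deform_frame hc)) :
  lifts a2 a2 (hopf_braiding (deform hc)) (hopf_braiding H) (Psi c).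
Proof.
rewrite !hopf_braiding_sandwich.
have lm := lifts_comp (@lifts_mulm k H c hc) 
  (lifts_tmap (@lifts_antipode k H c hc) (@lifts_mulm k H c hc)).
have lD := lifts_comp (lifts_tmap (lifts_id (deform_frame hc))
  (@lifts_comul k H c hc)) (@lifts_comul k H c hc).
have l := lifts_comp (lifts_sandwich lm)
  (lifts_tmap (lifts_id (deform_frame hc)) lD).
by apply: (lifts_eq l); rewrite ?Psi_sandwich ?lmap_simp.
Qed.

(** The two sides of the braid equation of the deformation lift those of H; the
    equality of the parts of degree one is the claim.  The same comparison gives
    the two mixed conditions. *)
Lemma Psi_YB c : hopf_cocycle c -> delta2_YB R (Psi c) = 0.
Proof.
move=> hc; have lR := @lifts_hopf_braiding c hc.
have l12 := lifts_op12 lR; have l23 := lifts_op23 lR.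
have l := lifts_comp (lifts_comp l12 l23) l12.
have r := lifts_comp (lifts_comp l23 l12) l23.
rewrite hopf_braiding_braid in l.
have [_ E] := lifts_inj l r.
rewrite !lcompDl addrA in E; rewrite /delta2_YB E.
apply/eqP; rewrite !subr_eq add0r; apply/eqP.
by rewrite [RHS](AC 3 (3*(2*1))).
Qed.

Lemma Psi_YI c : hopf_cocycle c -> delta2_YI mulm R (Psi c, c.1) = 0.
Proof.
move=> hc; have lR := @lifts_hopf_braiding c hc.
have lm := @lifts_mulm k H c hc.
have l := lifts_comp (lifts_comp (lifts_con23 lm) (lifts_op12 lR)) (lifts_op23 lR).
have r := lifts_comp lR (lifts_con12 lm).
rewrite hopf_braiding_con12 in l.
have [_ E] := lifts_inj l r.
rewrite !lcompDl in E; rewrite /delta2_YI.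
apply/eqP; rewrite !subr_eq add0r; apply/eqP.
by rewrite [LHS]addrC [X in _ + X]addrC E addrC.
Qed.

Lemma Psi_IY c : hopf_cocycle c -> delta2_IY mulm R (Psi c, c.1) = 0.
Proof.
move=> hc; have lR := @lifts_hopf_braiding c hc.
have lm := @lifts_mulm k H c hc.
have l := lifts_comp (lifts_comp (lifts_con12 lm) (lifts_op23 lR)) (lifts_op12 lR).
have r := lifts_comp lR (lifts_con23 lm).
rewrite hopf_braiding_con23 in l.
have [_ E] := lifts_inj l r.
rewrite !lcompDl in E; rewrite /delta2_IY.
apply/eqP; rewrite !subr_eq add0r; apply/eqP.
by rewrite [LHS]addrC [X in _ + X]addrC E addrC.
Qed.

Lemma Psi_cocycle (z : Z2_Hf H) :
  (Psi (submod_val z), (submod_val z).1) \in ker_pred (delta2_YBH mulm R).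
Proof.
have /eqP dH := hopf_cocycle_Hochschild z.
case: z dH => c /= /asboolP hc dH; apply/eqP.
by congr (_, _, _, _); [apply: Psi_YB|apply: Psi_YI|apply: Psi_IY|].
Qed.

Lemma Psi_funE c (x y : H) (S := @antipode k H) : Psi_fun c x y =
  (\sw_(y1, y2, y3 <- comul3 y) y1 ⊗ (S y2 * c.1 (x ⊗ y3)))
  + (\sw_(y1, y2, y3 <- comul3 y) y1 ⊗ c.1 (S y2 ⊗ (x * y3)))
  + (\sw_(a, b, d <- (lid ⊠ comul) (c.2 y)) a ⊗ (S b * x * d))
  + (\sw_(a, b, d <- (lid ⊠ c.2) (comul y)) a ⊗ (S b * x * d))
  + (\sw_(y1, y2, y3 <- comul3 y) y1 ⊗ (antipode' c y2 * x * y3)).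
Proof. by case: c. Qed.

Fact Psi_linear : linear (@Psi k H).
Proof.
move=> a c d; apply: tlift_unique => x y; rewrite lmapDE lmapZE !tliftE.
have l : linear (fun c => Psi_fun c x y).
  rewrite (funext (fun c => Psi_funE c x y)) /antipode' /comul3; lin.
exact: l.
Qed.

(** * Coboundaries as gauge transformations *)

Section Gauge.
Variable f : {linear H -> H}.
Local Notation c := (delta1_Hf H f).
Local Notation ε := (@counit k H).

Lemma delta1_Hf_mulE x y : c.1 (x ⊗ y) = x * f y + f x * y - f (x * y).
Proof.
change (mulm ((lid ⊠ f) (x ⊗ y)) + mulm ((f ⊠ lid) (x ⊗ y)) - f (mulm (x ⊗ y))
  = x * f y + f x * y - f (x * y)).
by rewrite !tmapE !mulmE.
Qed.
Lemma delta1_Hf_comulE x :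
  c.2 x = comul (f x) - ((f ⊠ lid) (comul x) + (lid ⊠ f) (comul x)).
Proof. by []. Qed.

Hypothesis hc : hopf_cocycle c.
Let h0 := hopf_cocycle0 H.
Local Notation A := (deform hc).
Local Notation B := (deform h0).
Local Notation a1 := (deform_frame hc).
Local Notation b1 := (deform_frame h0).

(** The map 1 + ħf, from the deformation by the coboundary of f to the trivial
    deformation. *)
Definition gauge : {linear A -> B} := lift_of a1 b1 lid f.
Lemma lifts_gauge : lifts a1 b1 gauge lid f.
Proof. exact: lift_ofP. Qed.

(** The normalization of ζ gives ε(f(x1)) x2 = 0; now apply ε. *)
Lemma coboundary_counit x : ε (f x) = 0.
Proof.
have : counitl_map H (c.2 x) = 0 by apply: hopf_cocycle_counitl hc x.
rewrite delta1_Hf_comulE (linearB (counitl_map H)) (linearD (counitl_map H)).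
rewrite counitl_mapK !tmap_tsumE !(linear_tsum (counitl_map H)).
have -> : \sw_(a, b <- comul x) counitl_map H (lid a ⊗ f b) = f x.
  rewrite -[RHS](@sweedler_counitl k H H x f); last exact: linearP.
  by apply: eq_tsum => a b; rewrite counitl_mapE.
rewrite opprD addrCA subrr addr0 => /eqP; rewrite oppr_eq0 => /eqP E.
have lε : linear (ε : H -> k^o) by move=> a u v; rewrite linearP.
have lεf : linear (fun u => ε (f u) : k^o) by move=> a u v; rewrite linearP lε.
rewrite -[LHS](@sweedler_counitr k H k^o x _ lεf).
have := congr1 (fun u => ε u) E; rewrite linear0 => {E} E.
rewrite -[RHS]E (linear_fun_tsum _ _ lε).
apply: eq_bigr => -[a b] _ /=; rewrite counitl_mapE linearZ /=.
exact: mulrC.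
Qed.

(** The part of degree one is f(x y) + ξ(x ⊗ y) = x f(y) + f(x) y. *)
Lemma gaugeM x y : gauge (x * y) = gauge x * gauge y.
Proof.
rewrite -[gauge _]/(ext lid f _) -[gauge x]/(ext lid f _) -[gauge y]/(ext lid f _).
apply: dualmodP; rewrite ?deformM1 ?deformM2 !(ext1, ext2) ?lidE //.
rewrite (@deformM2 k H c hc) (@deformM1 k H c hc) delta1_Hf_mulE.
rewrite [X in _ = _ + X](_ : _ = 0) // addr0 mulrDr mulrDl.
by rewrite -[LHS]addrA subrK addrACA.
Qed.

(** The part of degree one is ζ + (f ⊗ 1 + 1 ⊗ f) Δ = Δ f. *)
Lemma gauge_comul x : comul (gauge x) = (gauge ⊠ gauge) (comul x).
Proof.
suff E : deform_comul h0 ∘ gauge = (gauge ⊠ gauge) ∘ deform_comul hc.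
  exact: (eq_lmap E).
have l := lifts_comp (@lifts_comul k H 0 h0) lifts_gauge.
have r := lifts_comp (lifts_tmap lifts_gauge lifts_gauge) (@lifts_comul k H c hc).
apply: (lifts_unique l (lifts_eq r _ _)); rewrite !tmap_lid ?lcomp1l ?lcomp1r //.
apply: lmapP => y.
change (c.2 y + (lid ⊠ f + f ⊠ lid) (comul y) = comul (f y) + 0).
by rewrite lmapDE delta1_Hf_comulE addr0 [X in _ + X]addrC subrK.
Qed.

Lemma gauge_counit x : counit (gauge x) = counit x.
Proof.
apply: dualP; first by [].
change (ε (x.2 + f x.1) = ε x.2); rewrite linearD.
by rewrite [X in _ + X]coboundary_counit addr0.
Qed.

(** Compare the parts of degree one in R (g ⊗ g) = (g ⊗ g) R_c, where g = 1 + ħf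
    and R_c = R + ħΨ(c): this reads R (1 ⊗ f + f ⊗ 1) = Ψ(c) + (1 ⊗ f + f ⊗ 1) R. *)
Lemma Psi_coboundary : (Psi c, c.1) = delta1_YBH mulm R f.
Proof.
have E := hopf_braiding_morph gaugeM gauge_comul gauge_counit.
have lg := lifts_tmap lifts_gauge lifts_gauge.
have l := lifts_comp (@lifts_hopf_braiding 0 h0) lg.
have r := lifts_comp lg (@lifts_hopf_braiding c hc).
rewrite E in l; have [_ {}E] := lifts_inj l r.
have Psi0 : Psi (0 : C2_Hf) = 0 by apply: (linear0 (mk_linear Psi_linear)).
rewrite Psi0 !tmap_lid lcomp0l addr0 lcomp1l lcompDr lcompDl in E.
congr (_, _); last first.
  apply: tlift_unique => x y; rewrite delta1_Hf_mulE.
  change (x * f y + f x * y - f (x * y) = mulm ((f ⊠ lid) (x ⊗ y))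
    + mulm ((lid ⊠ f) (x ⊗ y)) - f (mulm (x ⊗ y))).
  by rewrite !tmapE !mulmE [X in X - _]addrC.
rewrite /delta1_YB -addrA -opprD [X in X - _]addrC E [X in _ - X]addrC.
by rewrite addrK.
Qed.
End Gauge.
End DegreeOne.

(** * The induced map in cohomology *)

Lemma quotmod_lift (k : comNzRingType) (M Q : lmodType k) (N : submodClosed M)
  (F : {linear M -> Q}) : (forall x, x \in N -> F x = 0) ->
  exists G : {linear quotmod N -> Q}, forall x, G (quotmod_pi N x) = F x.
Proof.
move=> F0.
(* A choice of representatives; F does not depend on it modulo N. *)
pose r (q : quotmod N) : M := sval (cid (quotmod_pi_surj q)).
have rK q : quotmod_pi N (r q) = q by rewrite -(svalP (cid (quotmod_pi_surj q))).
have Feq x y : quotmod_pi N x = quotmod_pi N y -> F x = F y.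
  by move/eqP; rewrite quotmod_piE => /F0 /eqP; rewrite linearB subr_eq0 => /eqP.
have lG : linear (fun q => F (r q)).
  move=> a p q; rewrite -linearP; apply: Feq.
  by rewrite linearP !rK.
by exists (mk_linear lG) => x; apply: Feq; rewrite rK.
Qed.

Section Classes.
Variables (k : comNzRingType) (H : hopfAlgType k).
Local Notation R := (hopf_braiding H).

Definition Psi_Z2 (z : Z2_Hf H) : Z2_YBH mulm R := SubMod (Psi_cocycle z).

Fact Psi_Z2_linear : linear Psi_Z2.
Proof.
move=> a x y; apply: val_inj.
pose u := submod_val x; pose v := submod_val y.
change ((Psi (a *: u + v), (a *: u + v).1)
  = a *: (Psi u, u.1) + (Psi v, v.1)).
by rewrite Psi_linear.
Qed.

Lemma class_YBH_eq0 (w : Z2_YBH mulm R) :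
  class_YBH w = 0 <-> submod_val w \in im_pred (delta1_YBH mulm R).
Proof.
rewrite -[0](linear0 class_YBH); split=> [/eqP|E]; last apply/eqP.
  by rewrite subquot_classE subr0.
by rewrite subquot_classE subr0.
Qed.

Lemma class_H_eq0 (w : Z2_H (@mulm k H)) :
  class_H w = 0 <-> submod_val w \in im_pred (delta1_H mulm).
Proof.
rewrite -[0](linear0 class_H); split=> [/eqP|E]; last apply/eqP.
  by rewrite subquot_classE subr0.
by rewrite subquot_classE subr0.
Qed.
End Classes.

Theorem theorem5p1 (k : comNzRingType) (H : hopfAlgType k) :
  exists Psi_bar : {linear H2_Hf H -> H2_YBH mulm (hopf_braiding H)},
    (forall c : Z2_Hf H,
      exists2 w : Z2_YBH mulm (hopf_braiding H),
        submod_val w = (Psi (submod_val c), (submod_val c).1) &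
        Psi_bar (class_Hf c) = class_YBH w) /\
    (forall c : Z2_Hf H,
      class_H (Hochschild_part c) <> 0 -> Psi_bar (class_Hf c) <> 0).
Proof.
pose F : {linear Z2_Hf H -> H2_YBH mulm (hopf_braiding H)} :=
  class_YBH ∘ mk_linear (@Psi_Z2_linear k H).
have F0 (z : Z2_Hf H) : z \in restr_pred (im_pred (delta1_Hf H)) -> F z = 0.
  case: z => c hc /asboolP[f /= E].
  apply/class_YBH_eq0/asboolP; exists f => /=; rewrite -E in hc *.
  by rewrite -(Psi_coboundary (f := f)) //; apply/asboolP.
have [G GE] := quotmod_lift F0.
exists G; split=> z; first by exists (Psi_Z2 z) => //; apply: GE.
apply: contra_not => Gz; apply/class_H_eq0.
have : class_YBH (Psi_Z2 z) = 0 by rewrite -Gz GE.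
move/class_YBH_eq0/asboolP => [f /(congr1 snd) /= E].
by apply/asboolP; exists f.
Qed.
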